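(* Let $R$ be a commutative Noetherian ring with identity, $\mathfrak{a}$ an ideal of $R$ which is contained in the Jacobson radical of $R$, and $M$ a finitely generated $\mathfrak{a}$-relative generalized Cohen-Macaulay $R$-module such that $c:=\mathrm{cd}(\mathfrak{a},M)=\mathrm{ara}(\mathfrak{a},M)$. Assume that $x_1,\ldots,x_c$ is an $\mathfrak{a}$-relative system of parameters ($\mathfrak{a}$-s.o.p) of $M$. Then: (i) $x_1,\ldots,x_c$ is an unconditioned $\mathfrak{a}$-filter regular sequence on $M$. (ii) For all $i=0,\ldots,c$, $M/\langle x_1,\ldots,x_i\rangle M$ is an $\mathfrak{a}$-relative generalized Cohen-Macaulay $R$-module and $\mathrm{cd}(\mathfrak{a},M/\langle x_1,\ldots,x_i\rangle M)=c-i$.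
   Context: For a finitely generated $R$-module $M$: $\mathrm{cd}(\mathfrak{a},M)$ is the supremum of the integers $i\ge 0$ with $H^i_{\mathfrak{a}}(M)\ne 0$ (with $\sup\emptyset=-\infty$), where $H^i_{\mathfrak{a}}$ is local cohomology; $\mathrm{f}_{\mathfrak{a}}(M)$ is the infimum of the integers $i\ge 0$ such that $H^i_{\mathfrak{a}}(M)$ is not finitely generated (with $\inf\emptyset=+\infty$); $\mathrm{ara}(\mathfrak{a},M)$ is the infimum of the integers $n\ge 0$ for which there exist $x_1,\ldots,x_n\in R$ such that $\langle x_1,\ldots,x_n\rangle$ and $\mathfrak{a}$ have the same radical in $R/\mathrm{Ann}_R M$. With $c=\mathrm{cd}(\mathfrak{a},M)$, a sequence $x_1,\ldots,x_c$ of elements of $\mathfrak{a}$ is an $\mathfrak{a}$-relative system of parameters ($\mathfrak{a}$-s.o.p) of $M$ if $\langle x_1,\ldots,x_c\rangle$ and $\mathfrak{a}$ have the same radical in $R/\mathrm{Ann}_R M$. A finitely generated $R$-module $M$ is $\mathfrak{a}$-relative generalized Cohen-Macaulay if $\mathrm{cd}(\mathfrak{a},M)\le 0$ or $\mathrm{cd}(\mathfrak{a},M)=\mathrm{f}_{\mathfrak{a}}(M)$. A sequence $x_1,\ldots,x_r$ in $R$ is an $\mathfrak{a}$-filter regular sequence on $M$ if $\langle x_1,\ldots,x_{i-1}\rangle M:_M x_i\subseteq\bigcup_{t\in\mathbb{N}}\left(\langle x_1,\ldots,x_{i-1}\rangle M:_M\mathfrak{a}^t\right)$ for all $i=1,\ldots,r$;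 it is unconditioned if it is $\mathfrak{a}$-filter regular on $M$ in any order. *)

(* Defs.v *)
From HB Require Import structures.
From mathcomp Require Import all_boot all_order all_algebra.
From mathcomp Require Import boolp classical_sets constructive_ereal.

Set Implicit Arguments.
Unset Strict Implicit.
Unset Printing Implicit Defensive.

Import Order.TTheory GRing.Theory Num.Theory.
Local Open Scope ring_scope.
Local Open Scope quotient_scope.

(** Ideals are the [R]-submodules of [R^o], so every construction on submodules
    below applies to ideals. Improper ideals are allowed. *)
Notation ideal R := (submodClosed R^o).

(** * Submodules *)

Section MkSubmod.
Variables (R : comPzRingType) (M : lmodType R) (P : M -> Prop).

Definition prop_submod_closed : Prop :=
  [/\ P 0, forall u v, P u -> P v -> P (u + v) & forall r u, P u -> P (r *: u)].

Fact asbool_submod_closed :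
  prop_submod_closed -> subsemimod_closed (fun m => `[< P m >]).
Proof.
case=> P0 PD PZ; split; first split.
- exact/asboolP.
- by move=> u v /asboolP Pu /asboolP Pv; apply/asboolP/PD.
- by move=> r u /asboolP Pu; apply/asboolP/PZ.
Qed.

Definition mksubmod (PM : prop_submod_closed) : submodClosed M :=
  HB.pack (fun m : M => `[< P m >])
    (GRing.isSubSemiModClosed.Build R M _ (asbool_submod_closed PM)).

Lemma mem_mksubmod (PM : prop_submod_closed) m : m \in mksubmod PM <-> P m.
Proof. by split=> /asboolP. Qed.

End MkSubmod.

Section Submodules.
Variables (R : comPzRingType) (M : lmodType R).

Fact fullmod_closed : prop_submod_closed (fun _ : M => True).
Proof. by []. Qed.
Definition fullmod : submodClosed M := mksubmod fullmod_closed.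

Definition in_genmod (s : seq M) (m : M) : Prop :=
  exists k : 'I_(size s) -> R, m = \sum_i k i *: s`_i.

Fact genmod_closed s : prop_submod_closed (in_genmod s).
Proof.
split.
- by exists (fun=> 0); rewrite big1 // => i _; rewrite scale0r.
- move=> u v [k ->] [l ->]; exists (fun i => k i + l i); rewrite -big_split.
  by apply: eq_bigr => i _; rewrite scalerDl.
- move=> r u [k ->]; exists (fun i => r * k i).
  by rewrite scaler_sumr; apply: eq_bigr => i _; rewrite scalerA.
Qed.
Definition genmod (s : seq M) : submodClosed M := mksubmod (genmod_closed s).

Definition in_smul (I : ideal R) (N : submodClosed M) (m : M) : Prop :=
  exists2 s : seq (R^o * M),
    all (fun p => (p.1 \in I) && (p.2 \in N)) s
    & m = \sum_(p <- s) (p.1 : R) *: p.2.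

Fact smul_closed I N : prop_submod_closed (in_smul I N).
Proof.
split.
- by exists [::]; rewrite ?big_nil.
- move=> u v [s sP ->] [t tP ->]; exists (s ++ t); last by rewrite big_cat.
  by rewrite all_cat sP.
- move=> r u [s sP ->]; exists [seq (p.1, r *: p.2) | p <- s].
    rewrite all_map; apply: sub_all sP => -[x m] /= /andP[-> mN].
    exact: rpredZ.
  rewrite big_map scaler_sumr; apply: eq_bigr => -[x m] _ /=.
  by rewrite !scalerA mulrC.
Qed.
(** [smul I N] is the submodule [I N]. *)
Definition smul (I : ideal R) (N : submodClosed M) : submodClosed M :=
  mksubmod (smul_closed I N).

Definition in_ann (r : R^o) : Prop := forall m : M, (r : R) *: m = 0.

Fact ann_closed : prop_submod_closed in_ann.
Proof.
split=> [m|r s r0 s0 m|t r r0 m]; first by rewrite scale0r.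
  by rewrite scalerDl r0 s0 addr0.
by rewrite -[t *: r]/((t : R) * (r : R)) -scalerA r0 scaler0.
Qed.
Definition ann : ideal R := mksubmod ann_closed.

Definition finitely_generated : Prop :=
  exists s : seq M, forall m : M, m \in genmod s.

End Submodules.
Arguments fullmod {R} M.
Arguments ann {R} M.

(** [seqmul x M] is the submodule [<x> M]. *)
Definition seqmul (R : comPzRingType) (x : seq R^o) (M : lmodType R) :
  submodClosed M := smul (genmod x) (fullmod M).

(** * Ideals *)

Section Ideals.
Variable R : comPzRingType.

Fixpoint idpow (a : ideal R) (t : nat) : ideal R :=
  if t is t'.+1 then smul a (idpow a t') else fullmod R^o.

Definition noetherian : Prop :=
  forall I : ideal R, exists s : seq R^o, I =i genmod s.

Definition maximal_ideal (m : ideal R) : Prop :=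
  ~ (m =i fullmod R^o) /\
  forall J : ideal R, {subset m <= J} -> J =i m \/ J =i fullmod R^o.

Definition in_jacobson_radical (r : R^o) : Prop :=
  forall m : ideal R, maximal_ideal m -> r \in m.

(** The class of [r] in [R / Ann M] lies in the radical of the image of [I]. *)
Definition in_radical_mod_ann (M : lmodType R) (I : ideal R) (r : R) : Prop :=
  exists n : nat, exists2 y : R^o, y \in I & (r ^+ n - y : R^o) \in ann M.

Definition same_radical_mod_ann (M : lmodType R) (I J : ideal R) : Prop :=
  forall r : R, in_radical_mod_ann M I r <-> in_radical_mod_ann M J r.

End Ideals.

(** * Submodules and quotients as modules *)

Section SubQuotient.
Variables (R : comPzRingType) (M : lmodType R) (N : submodClosed M).

Record submod : Type := Submod { submod_val : M; submodP : submod_val \in N }.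
HB.instance Definition _ := [isSub for submod_val].
HB.instance Definition _ := [Choice of submod by <:].
HB.instance Definition _ := [SubChoice_isSubLmodule of submod by <:].

(* [Quotient.quot] wants a [zmodClosed], from which [submodClosed] does not
   inherit although closure under opposites follows from that under scaling. *)
Fact submod_zmod_closed : zmod_closed (fun m : M => m \in N).
Proof.
split=> [|u v uN vN]; rewrite unfold_in ?rpred0 //.
by rewrite -scaleN1r rpredD ?rpredZ.
Qed.
Definition zmod_of_submod : zmodClosed M :=
  HB.pack (fun m : M => m \in N)
    (GRing.isZmodClosed.Build M _ submod_zmod_closed).

Definition quotmod : Type := Quotient.quot zmod_of_submod.
HB.instance Definition _ := GRing.Zmodule.on quotmod.

Definition quot_proj (m : M) : quotmod := \pi_(Quotient.quot zmod_of_submod) m.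
Definition quot_repr (q : quotmod) : M :=
  repr (q : Quotient.quot zmod_of_submod).

Lemma quot_reprK : cancel quot_repr quot_proj.
Proof. exact: reprK. Qed.

Lemma quot_projD : {morph quot_proj : u v / u + v}.
Proof. by move=> u v; rewrite /quot_proj Quotient.pi_add. Qed.

Lemma quot_projE u v : quot_proj u = quot_proj v <-> u - v \in N.
Proof.
rewrite -[u - v \in N]/(u - v \in zmod_of_submod) Quotient.idealrBE.
by split=> [uv|/eqP]; first exact/eqP.
Qed.

Definition quot_scale (r : R) (q : quotmod) : quotmod :=
  quot_proj (r *: quot_repr q).

Lemma quot_projZ r m : quot_proj (r *: m) = quot_scale r (quot_proj m).
Proof.
apply/quot_projE; rewrite -scalerBr rpredZ //.
by apply/quot_projE; rewrite quot_reprK.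
Qed.

Fact quot_scaleA r s q : quot_scale r (quot_scale s q) = quot_scale (r * s) q.
Proof. by rewrite -(quot_reprK q) -!quot_projZ scalerA. Qed.

Fact quot_scale1 : left_id 1 quot_scale.
Proof. by move=> q; rewrite -(quot_reprK q) -!quot_projZ scale1r. Qed.

Fact quot_scaleDr : right_distributive quot_scale +%R.
Proof.
move=> r p q; rewrite -(quot_reprK p) -(quot_reprK q).
by rewrite -quot_projD -!quot_projZ scalerDr quot_projD.
Qed.

Fact quot_scaleDl q : {morph quot_scale^~ q : r s / r + s}.
Proof.
by move=> r s; rewrite -(quot_reprK q) -!quot_projZ scalerDl quot_projD.
Qed.

HB.instance Definition _ := GRing.Zmodule_isLmodule.Build R quotmod
  quot_scaleA quot_scale1 quot_scaleDr quot_scaleDl.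

End SubQuotient.

(** * Cochain complexes *)

Section Complexes.
Variable R : comPzRingType.

Record cochain : Type := Cochain {
  cc_obj :> nat -> lmodType R;
  cc_diff : forall i, {linear cc_obj i -> cc_obj i.+1};
  cc_diffK : forall i x, cc_diff i.+1 (cc_diff i x) = 0 }.

Definition in_cocycles (C : cochain) (i : nat) (z : C i) : Prop :=
  cc_diff C i z = 0.

Fact cocycles_closed (C : cochain) i : prop_submod_closed (@in_cocycles C i).
Proof.
rewrite /in_cocycles; split=> [|u v u0 v0|r u u0]; first exact: linear0.
  by rewrite linearD u0 v0 addr0.
by rewrite linearZ_LR u0 scaler0.
Qed.
Definition cocycles (C : cochain) i : submodClosed (C i) :=
  mksubmod (@cocycles_closed C i).

Definition in_coboundaries (C : cochain) (i : nat) : C i -> Prop :=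
  match i with
  | 0 => fun z => z = 0
  | j.+1 => fun z => exists y, z = cc_diff C j y
  end.

(** The coboundaries, as a submodule of the module of cocycles. *)
Definition in_coboundaries_cocycles (C : cochain) i (z : submod (cocycles C i))
  : Prop := @in_coboundaries C i (val z).

Fact coboundaries_closed (C : cochain) i :
  prop_submod_closed (@in_coboundaries_cocycles C i).
Proof.
rewrite /in_coboundaries_cocycles; split=> [|u v|r u].
- by rewrite raddf0; case: i => [|i] //=; exists 0; rewrite linear0.
- rewrite raddfD; case: i u v => [|i] u v /=.
    by move=> -> ->; rewrite addr0.
  by move=> [x ->] [y ->]; exists (x + y); rewrite linearD.
- rewrite linearZ; case: i u => [|i] u /=; first by move=> ->; rewrite scaler0.
  by move=> [x ->]; exists (r *: x); rewrite linearZ.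
Qed.
Definition coboundaries (C : cochain) i :
  submodClosed (submod (cocycles C i)) := mksubmod (@coboundaries_closed C i).

Definition cohomology (C : cochain) (i : nat) : lmodType R :=
  quotmod (coboundaries C i).

(** * Injective resolutions *)

Definition injective_module (E : lmodType R) : Prop :=
  forall (A B : lmodType R) (f : {linear A -> B}) (g : {linear A -> E}),
    injective f -> exists h : {linear B -> E}, forall x, h (f x) = g x.

Definition injective_resolution_of (M : lmodType R) (E : cochain) : Prop :=
  (forall i, injective_module (E i)) /\
  exists eta : {linear M -> E 0},
  [/\ injective eta,
      forall z : E 0, cc_diff E 0 z = 0 <-> exists m, z = eta m
    & forall i (z : E i.+1),
        cc_diff E i.+1 z = 0 <-> exists y, z = cc_diff E i y].

Fact zero_diffK (M : lmodType R) (i : nat) (x : M) :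
  (\0 : {linear M -> M}) ((\0 : {linear M -> M}) x) = 0.
Proof. by []. Qed.

(** A chosen injective resolution of [M]. Every module has one, so that the
    default value, which only makes the function total, is never used. *)
Definition injective_resolution (M : lmodType R) : cochain :=
  if pselect (exists E, injective_resolution_of M E) is left exE
  then sval (cid exE)
  else @Cochain (fun=> M) (fun=> \0) (@zero_diffK M).

End Complexes.

(** * Local cohomology *)

Section LocalCohomology.
Variables (R : comPzRingType) (a : ideal R).

Lemma idpow_desc t t' : (t <= t')%N -> {subset idpow a t' <= idpow a t}.
Proof.
elim: t' => [|t' IH]; first by rewrite leqn0 => /eqP->.
rewrite leq_eqVlt => /predU1P[-> //|/IH sub] r; move=> rt; apply: sub.
case/mem_mksubmod: rt => s sP ->; rewrite big_seq; apply: rpred_sum => p ps.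
by apply: rpredZ; case/andP: (allP sP p ps).
Qed.

Definition in_torsion (M : lmodType R) (m : M) : Prop :=
  exists t : nat, forall r : R^o, r \in idpow a t -> (r : R) *: m = 0.

Fact torsion_closed M : prop_submod_closed (@in_torsion M).
Proof.
split.
- by exists 0%N => r _; rewrite scaler0.
- move=> u v [s us] [t vt]; exists (maxn s t) => r rst.
  rewrite scalerDr us ?vt ?addr0 //.
    exact: idpow_desc (leq_maxr s t) _ rst.
  exact: idpow_desc (leq_maxl s t) _ rst.
- move=> r u [t ut]; exists t => x xt.
  by rewrite scalerA mulrC -scalerA ut // scaler0.
Qed.
(** The [a]-torsion functor [Gamma_a], on objects and on morphisms. *)
Definition torsion (M : lmodType R) : submodClosed M :=
  mksubmod (@torsion_closed M).

Fact torsion_map_subproof (M N : lmodType R) (f : {linear M -> N})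
  (m : submod (torsion M)) : f (val m) \in torsion N.
Proof.
apply/mem_mksubmod; case/mem_mksubmod: (valP m) => t mt.
by exists t => r rt; rewrite -linearZ_LR mt // linear0.
Qed.
Definition torsion_map (M N : lmodType R) (f : {linear M -> N})
  (m : submod (torsion M)) : submod (torsion N) :=
  Submod (torsion_map_subproof f m).

Fact torsion_map_linear M N f : linear (@torsion_map M N f).
Proof. by move=> r u v; apply: val_inj; rewrite /= !linearP. Qed.
HB.instance Definition _ M N f := GRing.isLinear.Build R
  (submod (torsion M)) (submod (torsion N)) _ (@torsion_map M N f)
  (@torsion_map_linear M N f).

Fact torsion_complex_diffK (C : cochain R) i x :
  torsion_map (cc_diff C i.+1) (torsion_map (cc_diff C i) x) = 0.
Proof. by apply: val_inj; rewrite /= cc_diffK. Qed.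
Definition torsion_complex (C : cochain R) : cochain R :=
  @Cochain R (fun i => submod (torsion (C i)))
    (fun i => torsion_map (cc_diff C i)) (@torsion_complex_diffK C).

(** [H^i_a] is the [i]-th right derived functor of [Gamma_a]. *)
Definition local_cohomology (i : nat) (M : lmodType R) : lmodType R :=
  cohomology (torsion_complex (injective_resolution M)) i.

(** * Invariants attached to an ideal and a module *)

Definition extnat (n : nat) : \bar int := (n%:Z)%:E.

Definition cd (M : lmodType R) : \bar int :=
  supremum -oo%E
    [set extnat i | i in [set i | exists h : local_cohomology i M, h != 0]].

(** The finiteness dimension [f_a(M)]. *)
Definition fdim (M : lmodType R) : \bar int :=
  infimum +oo%E
    [set extnat i | i in
       [set i | ~ finitely_generated (local_cohomology i M)]].

Definition ara (M : lmodType R) : \bar int :=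
  infimum +oo%E
    [set extnat n | n in
       [set n | exists x : n.-tuple R^o, same_radical_mod_ann M (genmod x) a]].

Definition relative_sop (M : lmodType R) (x : seq R^o) : Prop :=
  [/\ cd M = extnat (size x), {subset x <= a}
    & same_radical_mod_ann M (genmod x) a].

Definition relative_gen_CM (M : lmodType R) : Prop :=
  finitely_generated M /\ ((cd M <= extnat 0)%E \/ cd M = fdim M).

(** In [filter_regular] the index [i] starts from [0], so that the submodule
    written there is generated by the terms preceding [x`_i]. *)
Definition filter_regular (M : lmodType R) (x : seq R^o) : Prop :=
  forall i : nat, (i < size x)%N -> forall m : M,
    (x`_i : R) *: m \in seqmul (take i x) M ->
    exists t : nat, forall r : R^o, r \in idpow a t ->
      (r : R) *: m \in seqmul (take i x) M.

Definition unconditioned_filter_regular (M : lmodType R) (x : seq R^o) : Prop :=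
  forall y : seq R^o, perm_eq y x -> filter_regular M y.

End LocalCohomology.

(* Main.v *)
(** The modules [N_i = M / <x_1, ..., x_i> M] inherit, for the remaining elements,
    the following situation: [a] is the radical of [<z_1, ..., z_d> + Ann N],
    [H^i_a(N)] is finitely generated for [i < d], and [H^d_a(N)] is nonzero.
    The key point is that [z_1] is then filter regular on [N]: if [z_1 m = 0],
    then [a] is the radical of [<z_2, ..., z_d> + Ann m], and an induction on
    [d] through quotients by a regular element of [z_1 + <z_2, ..., z_d> +
    (a inter Ann m)] shows that [m] is torsion.  As [0 :_N z_1] is acyclic, the
    sequences of [0 -> 0 :_N z_1 -> N -> z_1 N -> 0] and
    [0 -> z_1 N -> N -> N / z_1 N -> 0] pass the situation on to [N / z_1 N].
    The same sequences give vanishing above [d] and, with Nakayama's lemma, that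
    the top local cohomology is not finitely generated when [d > 0].

    The long exact sequence comes from the comparison theorem alone: the shifted
    cone [E_B^n x E_C^(n-1)] of a lifting of [B -> C] to injective resolutions is
    an injective resolution of the kernel. *)

From HB Require Import structures.
Require Import Defs.
From mathcomp Require Import all_boot all_order all_algebra.
From mathcomp Require Import boolp classical_sets constructive_ereal.

Set Implicit Arguments.
Unset Strict Implicit.
Unset Printing Implicit Defensive.

Import Order.TTheory GRing.Theory Num.Theory.

(** * Noetherian modules *)

(** The induction for the key point turns on uniformity. Each element of local cohomology is killed
    by some power of r in a, but finite generation gives one exponent n with r^n H^1_a(N) = 0. Once
    torsion is divided out, the torsion of N / y^s N embeds into H^1_a(N) for every s, so the same n
    serves all s and a Krull intersection argument yields r^n m = 0. The regular element y cannot be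
    z_1, whose regularity is out of reach. It is taken in the coset z_1 + <z_2, ..., z_d> + (a inter
    Ann m) because y m and z_1 m then differ by an element of <z_2, ..., z_d> m. So modulo y^s the
    term z_1 can still be dropped from the elements covering m. Non-vanishing of H^d_a(N) belongs to
    the invariant because it fixes cd. It descends since H^d_a(N) is a-torsion: if H^(d-1)_a(N / z_1
    N) were zero, z_1 would act injectively on H^d_a(N), forcing it to vanish. Acyclicity of torsion
    modules, on which every step relies, comes from the torsion functor preserving injectives over a
    noetherian ring. *)

Section Submodules.
Local Open Scope ring_scope.
Variables (R : comPzRingType) (M : lmodType R).
Implicit Types (N : submodClosed M) (s : seq M).

Lemma submodZ N k u : u \in N -> k *: u \in N.
Proof. exact: rpredZ. Qed.

Lemma submodN N u : u \in N -> - u \in N.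
Proof. by move=> uN; rewrite -scaleN1r rpredZ. Qed.

Lemma submodB N u v : u \in N -> v \in N -> u - v \in N.
Proof. by move=> uN vN; rewrite rpredD ?submodN. Qed.

Lemma genmod_nil m : m \in genmod [::] <-> m = 0 :> M.
Proof.
split=> [/mem_mksubmod[k ->]|->]; last exact: rpred0.
by rewrite big1 // => -[].
Qed.

Lemma genmod_cons h s m :
  m \in genmod (h :: s) <-> exists r, exists2 u, u \in genmod s & m = r *: h + u.
Proof.
split=> [/mem_mksubmod[k ->]|[r [u /mem_mksubmod[k ->] ->]]].
  rewrite big_ord_recl; exists (k ord0), (\sum_i k (lift ord0 i) *: s`_i) => //.
  by apply/mem_mksubmod; exists (fun i => k (lift ord0 i)).
apply/mem_mksubmod.
exists (fun i => if unlift ord0 i is Some j then k j else r).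
rewrite big_ord_recl unlift_none; congr (_ + _).
by apply: eq_bigr => i _; rewrite liftK.
Qed.

Lemma mem_genmod s m : m \in s -> m \in genmod s.
Proof.
elim: s => // h s IH; rewrite in_cons => /orP[/eqP->|ms]; apply/genmod_cons.
  by exists 1, 0; rewrite ?rpred0 // scale1r addr0.
by exists 0, m; rewrite ?IH // scale0r add0r.
Qed.

Lemma genmod_min s N : {subset s <= N} -> {subset genmod s <= N}.
Proof.
elim: s => [|h s IH] sN m; first by move/genmod_nil->; exact: rpred0.
move/genmod_cons=> [r [u us ->]]; apply: rpredD.
  by apply: rpredZ; apply: sN; exact: mem_head.
by apply: (IH _ _ us) => v vs; apply: sN; rewrite in_cons vs orbT.
Qed.

Lemma genmod_sub s t : {subset s <= t} -> {subset genmod s <= genmod t}.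
Proof. by move=> st; apply: genmod_min => u /st/mem_genmod. Qed.

Definition noetherian_module := forall N, exists s, N =i genmod s.

Definition in_bigcup_submod (u : nat -> submodClosed M) m := exists n, m \in u n.

Lemma chain_sub (u : nat -> submodClosed M) :
  (forall n, {subset u n <= u n.+1}) ->
  forall i j, (i <= j)%N -> {subset u i <= u j}.
Proof.
move=> uS i j /subnK<-; elim: (j - i)%N => // n IH m mi.
by rewrite addSn; apply/uS/IH.
Qed.

Lemma bigcup_submod_closed (u : nat -> submodClosed M) :
  (forall n, {subset u n <= u n.+1}) -> prop_submod_closed (in_bigcup_submod u).
Proof.
move=> /chain_sub uS; split.
- by exists 0%N; exact: rpred0.
- move=> x y [i xi] [j yj]; exists (maxn i j).
  by apply: rpredD; [apply: uS xi; exact: leq_maxl|apply: uS yj; exact: leq_maxr].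
- by move=> r x [i xi]; exists i; rewrite rpredZ.
Qed.

Lemma noetherian_acc (u : nat -> submodClosed M) :
  noetherian_module -> (forall n, {subset u n <= u n.+1}) ->
  exists n, forall m, {subset u m <= u n}.
Proof.
move=> nM uS; have [s sE] := nM (mksubmod (bigcup_submod_closed uS)).
suff [n sn] : exists n, {subset s <= u n}.
  exists n => m x xm; apply: (genmod_min sn).
  by rewrite -sE; apply/mem_mksubmod; exists m.
have: forall x, x \in s -> exists n, x \in u n.
  by move=> x /mem_genmod; rewrite -sE => /mem_mksubmod.
elim: s {sE} => [|h s IH] sU; first by exists 0%N.
have [|n sn] := IH; first by move=> x xs; apply: sU; rewrite in_cons xs orbT.
have [k hk] := sU h (mem_head _ _); exists (maxn n k) => x.
rewrite in_cons => /orP[/eqP->|/sn].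
  by apply: (chain_sub uS) hk; rewrite leq_maxr.
by apply: (chain_sub uS); rewrite leq_maxl.
Qed.

Lemma noetherian_max (P : submodClosed M -> Prop) N0 :
  noetherian_module -> P N0 ->
  exists N, [/\ P N, {subset N0 <= N}
    & forall N', P N' -> {subset N <= N'} -> {subset N' <= N}].
Proof.
move=> nM P0; apply: contrapT => noM.
have step (X : {N | P N /\ {subset N0 <= N}}) :
    {Y : {N | P N /\ {subset N0 <= N}} |
      {subset sval X <= sval Y} /\ ~ {subset sval Y <= sval X}}.
  case: X => N [PN N0N] /=; apply: cid; apply: contrapT => h; apply: noM.
  exists N; split=> // N' PN' NN'; apply: contrapT => N'N; apply: h.
  have N0N' : {subset N0 <= N'} by move=> x /N0N/NN'.
  by exists (exist _ N' (conj PN' N0N')).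
pose u := fix u n := if n is k.+1 then sval (step (u k)) else
  exist (fun N => P N /\ {subset N0 <= N}) N0 (conj P0 (fun _ => id)).
have [n|n un] := @noetherian_acc (fun n => sval (u n)) nM.
  by rewrite /=; case: (step (u n)) => ? [].
by have := un n.+1; rewrite /=; case: (step (u n)) => ? [].
Qed.

End Submodules.

Section NoetherianRing.
Local Open Scope ring_scope.
Variable R : comPzRingType.
Hypothesis R_noetherian : noetherian R.

(** Induction on the generators. The coefficients of [h] in elements of [N] form an ideal, finitely
    generated by [R_noetherian]. Lifts of its generators to [N], together with generators of the
    intersection of [N] with [genmod s], generate [N]. *)
Lemma noetherian_sub_genmod (M : lmodType R) (s : seq M) (N : submodClosed M) :
  {subset N <= genmod s} -> exists t, N =i genmod t.
Proof.
elim: s N => [|h s IH] N Ns.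
  by exists [::] => m; apply/idP/idP=> [/Ns|/genmod_nil->] //; exact: rpred0.
pose PI (r : R^o) := exists2 n, n \in N & n - (r : R) *: h \in genmod s.
have PIc : prop_submod_closed PI.
  split.
  - by exists 0; rewrite ?rpred0 // scale0r subr0 rpred0.
  - move=> r r' [n nN nr] [n' n'N nr']; exists (n + n'); first exact: rpredD.
    by rewrite scalerDl opprD addrACA rpredD.
  - move=> k r [n nN nr]; exists (k *: n); first exact: rpredZ.
    by rewrite -[(k *: r : R)]/((k : R) * r) -scalerA -scalerBr rpredZ.
have PNc : prop_submod_closed (fun m : M => m \in N /\ m \in genmod s).
  split=> [|u v [? ?] [? ?]|r u [? ?]]; split; try exact: rpred0;
  by rewrite ?rpredD ?rpredZ.
have [|t tE] := IH (mksubmod PNc); first by move=> m /mem_mksubmod[].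
have [I IE] := R_noetherian (mksubmod PIc).
have [v vN vI] : exists2 v : seq M, {subset v <= N} &
    forall r : R^o, r \in genmod I ->
    exists2 n, n \in genmod v & n - (r : R) *: h \in genmod s.
  have : forall r, r \in I -> PI r.
    by move=> r /mem_genmod; rewrite -IE => /mem_mksubmod.
  elim: I {IE} => [|i I IHI] PIi.
    exists [::] => // r /genmod_nil->; exists 0; first exact: rpred0.
    by rewrite scale0r subr0 rpred0.
  have [|v vN vI] := IHI.
    by move=> r rI; apply: PIi; rewrite in_cons rI orbT.
  have [n nN ni] := PIi i (mem_head _ _).
  exists (n :: v) => [m|r /genmod_cons[k [r' r'I ->]]].
    by rewrite in_cons => /orP[/eqP->|/vN].
  have [n' n'v n'r] := vI _ r'I; exists (k *: n + n').
    by apply/genmod_cons; exists k, n'.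
  rewrite scalerDl opprD addrACA rpredD //.
  by rewrite -[(k *: i : R)]/((k : R) * i) -scalerA -scalerBr rpredZ.
exists (v ++ t) => m; apply/idP/idP => [mN|].
  have /genmod_cons[r [u us mE]] := Ns _ mN.
  have rI : (r : R^o) \in genmod I.
    by rewrite -IE; apply/mem_mksubmod; exists m; rewrite // mE addrC addKr.
  have [n nv nr] := vI _ rI; rewrite -(subrK n m) rpredD //; last first.
    by apply: genmod_sub nv => x xv; rewrite mem_cat xv.
  have nN : n \in N by apply: genmod_min nv.
  have : m - n \in mksubmod PNc.
    apply/mem_mksubmod; split; first exact: submodB.
    rewrite mE -[n](subrK (r *: h)) [_ + r *: h]addrC opprD addrACA subrr add0r.
    exact: submodB.
  rewrite tE; apply: genmod_sub => x xt; by rewrite mem_cat xt orbT.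
apply: genmod_min => x; rewrite mem_cat => /orP[/vN//|/mem_genmod].
by rewrite -tE => /mem_mksubmod[].
Qed.

Lemma fg_noetherian (M : lmodType R) :
  finitely_generated M -> noetherian_module M.
Proof. by case=> s sM N; apply: (@noetherian_sub_genmod _ s). Qed.

End NoetherianRing.

(** * Linear maps, factorization through quotients, finite generation of extensions *)

Section LinearMaps.
Local Open Scope ring_scope.
Variable R : comPzRingType.

Definition mklinear (A B : lmodType R) (f : A -> B) (fL : linear f) :
  {linear A -> B} := HB.pack f (GRing.isLinear.Build R A B *:%R f fL).

Lemma quot_proj_linear (M : lmodType R) (N : submodClosed M) :
  linear (@quot_proj R M N).
Proof. by move=> r u v; rewrite quot_projD quot_projZ. Qed.
Definition quot_map (M : lmodType R) (N : submodClosed M) :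
  {linear M -> quotmod N} := mklinear (@quot_proj_linear M N).

Lemma quot_map_eq0 (M : lmodType R) (N : submodClosed M) m :
  quot_map N m = 0 <-> m \in N.
Proof. by rewrite -[m in m \in N]subr0 -quot_projE -(linear0 (quot_map N)). Qed.

Lemma quot_map_surj (M : lmodType R) (N : submodClosed M) q :
  exists m, q = quot_map N m.
Proof. by exists (quot_repr q); rewrite -[LHS]quot_reprK. Qed.

Lemma submod_val_linear (M : lmodType R) (N : submodClosed M) :
  linear (@submod_val R M N).
Proof. by []. Qed.
Definition submod_incl (M : lmodType R) (N : submodClosed M) :
  {linear submod N -> M} := mklinear (@submod_val_linear M N).

Lemma submod_incl_inj (M : lmodType R) (N : submodClosed M) :
  injective (submod_incl N).
Proof. exact: val_inj. Qed.

Lemma corestrict_linear (A B : lmodType R) (N : submodClosed B)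
  (f : {linear A -> B}) (fN : forall x, f x \in N) :
  linear (fun x => Submod (fN x)).
Proof. by move=> r u v; apply: val_inj; rewrite /= linearP. Qed.
Definition corestrict (A B : lmodType R) (N : submodClosed B)
  (f : {linear A -> B}) (fN : forall x, f x \in N) : {linear A -> submod N} :=
  mklinear (corestrict_linear fN).

Lemma scale_linear (M : lmodType R) (x : R) : linear (fun m : M => x *: m).
Proof. by move=> r u v; rewrite scalerDr !scalerA mulrC. Qed.
Definition scale_map (M : lmodType R) (x : R) : {linear M -> M} :=
  mklinear (scale_linear x).

Lemma comp_linear (A B C : lmodType R) (g : {linear B -> C})
  (f : {linear A -> B}) : linear (g \o f).
Proof. by move=> r u v; rewrite /= !linearP. Qed.
Definition comp_map (A B C : lmodType R) (g : {linear B -> C})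
  (f : {linear A -> B}) : {linear A -> C} := mklinear (comp_linear g f).

Lemma in_ker_closed (A B : lmodType R) (f : {linear A -> B}) :
  prop_submod_closed (fun x => f x = 0).
Proof.
split=> [|u v u0 v0|r u u0]; first exact: linear0.
  by rewrite linearD u0 v0 addr0.
by rewrite linearZ_LR u0 scaler0.
Qed.
Definition kermod (A B : lmodType R) (f : {linear A -> B}) : submodClosed A :=
  mksubmod (in_ker_closed f).

Lemma in_img_closed (A B : lmodType R) (f : {linear A -> B}) :
  prop_submod_closed (fun y => exists x, y = f x).
Proof.
split=> [|_ _ [x ->] [y ->]|r _ [x ->]]; first by exists 0; rewrite linear0.
  by exists (x + y); rewrite linearD.
by exists (r *: x); rewrite linearZ_LR.
Qed.
Definition imgmod (A B : lmodType R) (f : {linear A -> B}) : submodClosed B :=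
  mksubmod (in_img_closed f).

Lemma factor_quotmod (A B : lmodType R) (N : submodClosed A)
  (f : {linear A -> B}) : (forall x, x \in N -> f x = 0) ->
  exists g : {linear quotmod N -> B}, forall x, g (quot_map N x) = f x.
Proof.
move=> fN; pose g (q : quotmod N) := f (quot_repr q).
have gE x : g (quot_map N x) = f x.
  apply/eqP; rewrite -subr_eq0 -linearB; apply/eqP/fN.
  by apply/quot_projE; rewrite quot_reprK.
have gL : linear g.
  move=> r p q; have [[u ->] [v ->]] := (quot_map_surj p, quot_map_surj q).
  by rewrite -linearP !gE linearP.
by exists (mklinear gL).
Qed.

Lemma fg_surj (A B : lmodType R) (f : {linear A -> B}) :
  (forall y, exists x, y = f x) -> finitely_generated A -> finitely_generated B.
Proof.
move=> f_surj [s sA]; exists (map f s) => y; have [x ->] := f_surj y.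
elim: s x {sA}(sA x) => [|h s IH] x.
  by move/genmod_nil->; rewrite linear0 rpred0.
move/genmod_cons=> [r [u /IH us ->]]; rewrite linearP.
by apply/genmod_cons; exists r, (f u).
Qed.

(** The image of [g] is finitely generated because [C] is noetherian. Lifts of its generators
    together with the images of generators of [A] generate [B]. *)
Lemma fg_extension (A B C : lmodType R) (f : {linear A -> B})
  (g : {linear B -> C}) :
  noetherian R -> (forall b, g b = 0 -> exists a, b = f a) ->
  finitely_generated A -> finitely_generated C -> finitely_generated B.
Proof.
move=> nR fg [s sA] /(fg_noetherian nR) nC.
have [t tE] := nC (imgmod g).
have [v gv] : exists v, forall c, c \in genmod t ->
    exists2 b, b \in genmod v & g b = c.
  have: forall c, c \in t -> exists b, c = g b.
    by move=> c /mem_genmod; rewrite -tE => /mem_mksubmod.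
  elim: t {tE} => [|h t IH] tg.
    by exists [::] => c /genmod_nil->; exists 0; rewrite ?rpred0 ?linear0.
  have [|v gv] := IH; first by move=> c ct; apply: tg; rewrite in_cons ct orbT.
  have [b bE] := tg h (mem_head _ _); exists (b :: v) => c.
  move/genmod_cons=> [r [u /gv[b' b'v b'u] ->]]; exists (r *: b + b').
    by apply/genmod_cons; exists r, b'.
  by rewrite linearP -bE b'u.
exists (map f s ++ v) => b.
have [|b' b'v b'E] := gv (g b); first by rewrite -tE; apply/mem_mksubmod; exists b.
have [|a aE] := fg (b - b'); first by rewrite linearB b'E subrr.
rewrite -(subrK b' b) aE; apply: rpredD; last first.
  by apply: genmod_sub b'v => x xv; rewrite mem_cat xv orbT.
suff fas : f a \in genmod (map f s).
  by apply: genmod_sub fas => x xv; rewrite mem_cat xv.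
elim: s a {sA aE}(sA a) => [|h s IH] a.
  by move/genmod_nil->; rewrite linear0 rpred0.
move/genmod_cons=> [r [u /IH us ->]]; rewrite linearP.
by apply/genmod_cons; exists r, (f u).
Qed.

End LinearMaps.

(** * Jacobson radical: Nakayama's lemma and a Krull intersection theorem *)

Section Jacobson.
Local Open Scope ring_scope.
Variable R : comPzRingType.
Hypothesis R_noetherian : noetherian R.

Lemma mem_ideal1 (I : ideal R) : (1 : R^o) \in I -> I =i fullmod R^o.
Proof.
move=> I1 r; apply/idP/idP => _; first exact/mem_mksubmod.
by rewrite -[r]mulr1 -[r * 1]/((r : R) *: (1 : R^o)) rpredZ.
Qed.

(** Otherwise <1 - r> is proper, and the noetherian condition, in place of Zorn's lemma, puts it in
    a maximal ideal. That ideal also contains [r], hence 1. *)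
Lemma jacobson_unit (r : R^o) :
  in_jacobson_radical r -> exists u : R, u * (1 - r) = 1.
Proof.
move=> rJ; apply: contrapT => nu.
pose P (I : ideal R) := (1 : R^o) \notin I.
have P0 : P (genmod [:: (1 - r : R^o)]).
  rewrite /P; apply/negP => /genmod_cons[u [v /genmod_nil-> e]]; apply: nu; exists u.
  by move: e; rewrite addr0; exact: esym.
have [I [I1 rI Imax]] := @noetherian_max _ _ P _ R_noetherian P0.
have Im : maximal_ideal I.
  split=> [If|J IJ]; first by move: I1; rewrite /P If => /negP; apply; exact/mem_mksubmod.
  have [J1|J1] := boolP ((1 : R^o) \in J); [right|left].
    exact: mem_ideal1.
  by move=> x; apply/idP/idP => [/(Imax _ J1 IJ)|/IJ].
move: I1; rewrite /P => /negP; apply.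
rewrite -[1 : R^o](subrK r) rpredD ?rJ //.
by apply/rI/mem_genmod; rewrite mem_head.
Qed.

Lemma jacobson_scale (x : R^o) (r : R) :
  in_jacobson_radical x -> in_jacobson_radical (r *: x).
Proof. by move=> xJ m mm; rewrite rpredZ ?xJ. Qed.

Lemma jacobson_fix (M : lmodType R) (x : R^o) (r : R) (m : M) :
  in_jacobson_radical x -> m = (r * x) *: m -> m = 0.
Proof.
move=> /(jacobson_scale r)/jacobson_unit[u u1] mE.
rewrite -[m]scale1r -u1 -scalerA scalerBl scale1r.
by rewrite -[X in _ *: (X - _)]/m {1}mE subrr scaler0.
Qed.

(** A generator [h] is redundant: h = x h' with h' = k h + v and [v] in the span of the others, so
    (1 - k x) h = x v, and 1 - k x is invertible. *)
Lemma nakayama (M : lmodType R) (x : R^o) :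
  finitely_generated M -> in_jacobson_radical x ->
  (forall m : M, exists m', m = (x : R) *: m') -> forall m : M, m = 0.
Proof.
move=> [s sM] xJ xM; elim: s sM => [|h s IH] sM.
  by move=> m; apply/genmod_nil.
apply: IH => m; have /genmod_cons[r [u us ->]] := sM m.
rewrite rpredD ?rpredZ //; have [h' hE] := xM h.
have /genmod_cons[k [v vs h'E]] := sM h'.
have [c c1] := jacobson_unit (jacobson_scale k xJ).
have -> : h = c *: ((x : R) *: v).
  have -> : (x : R) *: v = (1 - k *: x : R) *: h.
    apply/eqP; rewrite scalerBl scale1r eq_sym subr_eq {1}hE h'E scalerDr.
    by rewrite scalerA [x * k]mulrC addrC.
  by rewrite scalerA c1 scale1r.
by rewrite !rpredZ.
Qed.

(** Write u = x^s v_s. Regularity gives v_s = x v_(s+1), so the cyclic submodules <v_s> increase and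
    stabilize. Then v_(n+1) = r v_n = r x v_(n+1), which forces v_(n+1) = 0. *)
Lemma krull_regular (M : lmodType R) (x : R^o) (u : M) :
  finitely_generated M -> in_jacobson_radical x ->
  (forall m : M, (x : R) *: m = 0 -> m = 0) ->
  (forall s, exists v, u = (x : R) ^+ s *: v) -> u = 0.
Proof.
move=> /(fg_noetherian R_noetherian) nM xJ xreg /choice[v vE].
have xsreg s (m : M) : (x : R) ^+ s *: m = 0 -> m = 0.
  elim: s => [|s IH]; first by rewrite expr0 scale1r.
  by rewrite exprS -scalerA => /xreg/IH.
have vS s : v s = (x : R) *: v s.+1.
  apply/eqP; rewrite -subr_eq0; apply/eqP/(xsreg s).
  by rewrite scalerBr scalerA -exprSr -!vE subrr.
have [n|n vn] := @noetherian_acc _ _ (fun s => genmod [:: v s]) nM.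
  apply: genmod_min => y; rewrite mem_seq1 => /eqP->; rewrite (vS n) rpredZ //.
  by rewrite mem_genmod ?mem_head.
have /genmod_cons[r [_ /genmod_nil-> vE']] : v n.+1 \in genmod [:: v n].
  by apply: (vn n.+1); rewrite mem_genmod ?mem_head.
have v0 : v n.+1 = 0.
  by apply: (jacobson_fix xJ (r := r)); rewrite -scalerA -vS vE' addr0.
by rewrite (vE n.+1) v0 scaler0.
Qed.

End Jacobson.

(** * Regular elements and torsion *)

Section PrimeAvoidance.
Local Open Scope ring_scope.
Variables (R : comPzRingType) (M : lmodType R).
Hypothesis R_noetherian : noetherian R.
Hypothesis M_noetherian : noetherian_module M.

Lemma in_annel_closed (m : M) :
  prop_submod_closed (fun r : R^o => (r : R) *: m = 0).
Proof.
split=> [|r s r0 s0|k r r0]; first exact: scale0r.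
  by rewrite scalerDl r0 s0 addr0.
by rewrite -[k *: r]/((k : R) * r) -scalerA r0 scaler0.
Qed.
Definition annel (m : M) : ideal R := mksubmod (in_annel_closed m).

Lemma annelP (m : M) (r : R) : (r : R^o) \in annel m <-> r *: m = 0.
Proof. exact: mem_mksubmod. Qed.

(** The annihilators of these elements are the maximal associated primes of [M]. *)
Definition max_annel (m : M) := m <> 0 /\
  forall m', m' <> 0 -> {subset annel m <= annel m'} ->
    {subset annel m' <= annel m}.

Lemma max_annel_prime (m : M) (r s : R) :
  max_annel m -> (r * s) *: m = 0 -> s *: m <> 0 -> r *: m = 0.
Proof.
move=> [_ mmax] rs0 s0; apply/annelP; apply: (mmax _ s0).
  by move=> t /annelP t0; apply/annelP; rewrite scalerA mulrC -scalerA t0 scaler0.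
by apply/annelP; rewrite scalerA.
Qed.

Lemma max_annel_above (m : M) :
  m <> 0 -> exists2 m', max_annel m' & {subset annel m <= annel m'}.
Proof.
move=> m0; pose P (I : ideal R) := exists2 m', m' <> 0 & I =i annel m'.
have Pm : P (annel m) by exists m.
have [I [[m' m'0 IE] mI Imax]] := @noetherian_max _ R^o P _ R_noetherian Pm.
exists m' => [|r /mI]; last by rewrite IE.
split=> // m'' m''0 m'm'' r rm''; rewrite -IE.
apply: (Imax (annel m'')) => // [|s sI]; first by exists m''.
by apply: m'm''; rewrite -IE.
Qed.

(** A maximal submodule among those generated by finitely many such elements contains all of them.
    This stands in for the finiteness of the set of associated primes. *)
Lemma finite_max_annel : exists2 L : seq M,
  (forall l, l \in L -> max_annel l) & forall m, max_annel m -> m \in genmod L.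
Proof.
pose P (N : submodClosed M) := exists2 L : seq M,
  (forall l, l \in L -> max_annel l) & N =i genmod L.
have P0 : P (genmod [::]) by exists [::].
have [N [[L Lmax NE] _ Nmax]] := noetherian_max M_noetherian P0.
exists L => // m mmax; rewrite -NE; apply: (Nmax (genmod (m :: L))).
- by exists (m :: L) => // l; rewrite in_cons => /orP[/eqP->|/Lmax].
- by move=> x; rewrite NE; apply: genmod_sub => y yL; rewrite in_cons yL orbT.
- by rewrite mem_genmod ?mem_head.
Qed.

Lemma annel_prod (m : M) (L : seq M) : max_annel m ->
  (forall l, l \in L -> exists2 p : R, p *: l = 0 & p *: m <> 0) ->
  exists2 p : R, forall l, l \in L -> p *: l = 0 & p *: m <> 0.
Proof.
move=> mmax; elim: L => [|l L IH] Lp.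
  by exists 1 => //; rewrite scale1r; case: mmax.
have [|p pL pm] := IH; first by move=> k kL; apply: Lp; rewrite in_cons kL orbT.
have [q ql qm] := Lp l (mem_head _ _); exists (q * p) => [k|qpm].
  rewrite in_cons => /orP[/eqP->|/pL pk].
    by rewrite mulrC -scalerA ql scaler0.
  by rewrite -scalerA pk scaler0.
by apply: qm; apply: (max_annel_prime mmax qpm).
Qed.

(** Enlarge the annihilator of [m] to a maximal one, that of [m']. If no [l] in [L] had its
    annihilator inside that of [m'], primality would give a product [p] killing [L] but not [m'],
    although [m'] lies in the span of [L]. Maximality of [l] turns the inclusion into equality. *)
Lemma zero_divisor_max_annel : exists2 L : seq M,
  (forall l, l \in L -> max_annel l) &
  forall (r : R) (m : M), m <> 0 -> r *: m = 0 -> exists2 l, l \in L & r *: l = 0.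
Proof.
have [L Lmax Lgen] := finite_max_annel; exists L => // r m m0 rm0.
have [m' m'max mm'] := max_annel_above m0.
have rm' : r *: m' = 0 by apply/annelP/mm'/annelP.
apply: contrapT => noL.
have [|p pL] := @annel_prod m' L m'max.
  move=> l lL; apply: contrapT => nop; apply: noL; exists l => //.
  have lm' : {subset annel l <= annel m'}.
    move=> t /annelP tl; apply/annelP; apply: contrapT => tm'.
    by apply: nop; exists t.
  by apply/annelP; apply: (proj2 (Lmax l lL) m' (proj1 m'max) lm'); apply/annelP.
apply; suff : m' \in kermod (scale_map M p) by move/mem_mksubmod.
by apply: genmod_min (Lgen _ m'max) => l lL; apply/mem_mksubmod/pL.
Qed.

(** Prime avoidance for the coset [z + I]: it leaves the union of the maximal associated primes as
    soon as none of them contains both [z] and [I]. The correction [w] is adjusted for one element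
    of [L] at a time. *)
Lemma regular_coset (z : R) (I : ideal R) :
  (forall m : M, max_annel m -> z *: m = 0 ->
     exists2 w : R^o, w \in I & (w : R) *: m <> 0) ->
  exists2 w : R^o, w \in I & forall m : M, (z + w : R) *: m = 0 -> m = 0.
Proof.
move=> zI; have [L Lmax Lzd] := zero_divisor_max_annel.
suff [w wI wL] : exists2 w : R^o, w \in I &
    forall l, l \in L -> (z + w : R) *: l <> 0.
  exists w => // m wm; apply: contrapT => m0.
  by have [l lL /wL] := Lzd _ _ m0 wm; apply.
elim: L Lmax {Lzd} => [|l0 L IH] Lmax; first by exists 0; rewrite ?rpred0.
have [|w wI wL] := IH; first by move=> l lL; apply: Lmax; rewrite in_cons lL orbT.
have l0max := Lmax l0 (mem_head _ _).
have [wl0|wl0] := EM ((z + w : R) *: l0 = 0); last first.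
  by exists w => // l; rewrite in_cons => /orP[/eqP->|/wL].
have [i iI il0] : exists2 i : R^o, i \in I & (i : R) *: l0 <> 0.
  apply: contrapT => nI.
  have [|i iI il0] := zI l0 l0max; last by apply: nI; exists i.
  have [wl0'|wl0'] := EM ((w : R) *: l0 = 0); last by case: nI; exists w.
  by move: wl0; rewrite scalerDl wl0' addr0.
(* If some [l] had its annihilator inside that of [l0], the two would be equal by maximality, and
   [z + w], which kills [l0], would kill [l]. So [p] kills the elements treated before but not [l0],
   and adding [p *: i] repairs [l0] without disturbing them. *)
have [|p pL pl0] := @annel_prod l0 L l0max.
  move=> l lL; apply: contrapT => nop; apply: (wL l lL).
  have ll0 : {subset annel l <= annel l0}.
    move=> t /annelP tl; apply/annelP; apply: contrapT => tl0.
    by apply: nop; exists t.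
  have lmax : max_annel l by apply: Lmax; rewrite in_cons lL orbT.
  by apply/annelP; apply: (proj2 lmax l0 (proj1 l0max) ll0); apply/annelP.
exists (w + p *: i); first by rewrite rpredD ?rpredZ.
move=> l; rewrite -[p *: i]/((p : R) * i) addrA scalerDl.
rewrite in_cons => /orP[/eqP->|lL].
  rewrite wl0 add0r mulrC => ip0.
  by apply: il0; apply: max_annel_prime l0max ip0 pl0.
by rewrite mulrC -[(i * p) *: l]scalerA pL // scaler0 addr0; apply: wL.
Qed.

End PrimeAvoidance.

(** * Torsion elements detected on powers of single elements *)

Section Torsion.
Local Open Scope ring_scope.
Variables (R : comPzRingType) (a : ideal R).

Lemma idpow_expr (r : R^o) n : r \in a -> ((r : R) ^+ n : R^o) \in idpow a n.
Proof.
move=> ra; elim: n => [|n IH]; first exact/mem_mksubmod.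
apply/mem_mksubmod; exists [:: (r, (r : R) ^+ n : R^o)].
  by rewrite /= ra IH.
by rewrite big_seq1 exprS.
Qed.

Lemma torsion_generators (M : lmodType R) (g : seq R^o) (u : M) :
  a =i genmod g -> (forall i, i \in g -> (i : R) *: u \in torsion a M) ->
  u \in torsion a M.
Proof.
move=> aE gu.
have [T gT] : exists T, forall i, i \in g ->
    forall q : R^o, q \in idpow a T -> (q : R) *: ((i : R) *: u) = 0.
  elim: g gu {aE} => [|i g IH] gu; first by exists 0%N.
  have [|T gT] := IH; first by move=> j jg; apply: gu; rewrite in_cons jg orbT.
  have /mem_mksubmod[t it] := gu i (mem_head _ _); exists (maxn t T) => j.
  rewrite in_cons => /orP[/eqP-> q|jg q] /idpow_desc qT.
    by apply: it; apply: qT; rewrite leq_maxl.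
  by apply: (gT j jg); apply: qT; rewrite leq_maxr.
apply/mem_mksubmod; exists T.+1 => r /mem_mksubmod[s sP ->].
rewrite scaler_suml big_seq big1 // => -[p q] /(allP sP)/andP[/= pa qT].
rewrite -[p *: q]/((p : R) * q) -scalerA.
suff : p \in annel ((q : R) *: u) by move/mem_mksubmod.
rewrite aE in pa; apply: genmod_min pa => i ig; apply/mem_mksubmod.
by rewrite scalerA mulrC -scalerA; apply: gT.
Qed.

(** No count of monomials is made. In [main], [L] lists the generators that may still send [u]
    outside the torsion. An inner induction on the exponent [n] shows that [l *: u] is torsion,
    which removes [l] from the list. *)
Lemma torsion_nilpotent_generators (M : lmodType R) (g : seq R^o) (m : M) :
  a =i genmod g -> (forall i, i \in g -> exists n, (i : R) ^+ n *: m = 0) ->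
  m \in torsion a M.
Proof.
move=> aE gm.
have {}gm r : r \in g -> exists n, (r : R) ^+ n *: m \in torsion a M.
  by case/gm=> n rn; exists n; rewrite rn rpred0.
suff main (L : seq R^o) (u : M) : (forall i, i \in g -> (i \in L) \/ (i : R) *: u \in torsion a M) ->
    (forall i, i \in L -> exists n, (i : R) ^+ n *: u \in torsion a M) ->
    u \in torsion a M.
  by apply: (main g) => // i ig; left.
elim: L u => [|l L IH] u gu Lu.
  by apply: (torsion_generators aE) => i /gu[].
have [n] := Lu l (mem_head _ _).
elim: n u gu Lu => [|n IHn] u gu Lu; first by rewrite expr0 scale1r.
rewrite exprSr -scalerA => lu.
have {}lu : (l : R) *: u \in torsion a M.
  apply: IHn lu => i; first by case/gu; [left|right; rewrite scalerA mulrC -scalerA rpredZ].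
  case/Lu=> k ku; exists k.
  by rewrite scalerA mulrC -scalerA rpredZ.
apply: IH => i.
  by case/gu; [rewrite in_cons => /orP[/eqP->|]; [right|left]|right].
by move=> iL; apply: Lu; rewrite in_cons iL orbT.
Qed.

Lemma torsionP (M : lmodType R) (m : M) : noetherian R ->
  m \in torsion a M <-> forall r : R^o, r \in a -> exists n, (r : R) ^+ n *: m = 0.
Proof.
move=> nR; split=> [/mem_mksubmod[t mt] r ra|am].
  by exists t; apply/mt/idpow_expr.
have [g aE] := nR a; apply: (torsion_nilpotent_generators aE) => i /mem_genmod ig.
by apply: am; rewrite aE.
Qed.

End Torsion.

(** * Injective modules *)

Section Injective.
Local Open Scope ring_scope.
Variable R : comPzRingType.

(** [d] need not be injective: both maps factor through the quotient by its kernel, where the factor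
    of [d] is. This form serves all later extensions along differentials. *)
Lemma injective_extension (E A B : lmodType R) (d : {linear A -> B})
  (g : {linear A -> E}) :
  injective_module E -> (forall x, d x = 0 -> g x = 0) ->
  exists h : {linear B -> E}, forall x, h (d x) = g x.
Proof.
move=> injE dg.
have [|d' d'E] := @factor_quotmod R A B (kermod d) d; first by move=> x /mem_mksubmod.
have [|g' g'E] := @factor_quotmod R A E (kermod d) g; first by move=> x /mem_mksubmod/dg.
have [|h hE] := injE _ _ d' g'.
  move=> p q; have [[u ->] [v ->]] := (quot_map_surj p, quot_map_surj q).
  rewrite !d'E => uv; apply/eqP; rewrite -subr_eq0 -linearB; apply/eqP.
  by apply/quot_map_eq0/mem_mksubmod; rewrite linearB uv subrr.
by exists h => x; rewrite -d'E hE g'E.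
Qed.

(** [g] is a function on all of [R] constrained only on [I], so that stating the criterion involves
    no subtype. *)
Definition baer (E : lmodType R) := forall (I : ideal R) (g : R^o -> E),
  (forall r s, r \in I -> s \in I -> g (r + s) = g r + g s) ->
  (forall k r, r \in I -> g ((k : R) *: r) = (k : R) *: g r) ->
  exists e, forall r, r \in I -> g r = (r : R) *: e.

Lemma injective_baer (E : lmodType R) : injective_module E -> baer E.
Proof.
move=> injE I g gD gZ.
have gL : linear (fun r : submod I => g (submod_val r)).
  by move=> k [r rI] [s sI] /=; rewrite gD ?gZ ?rpredZ.
have [h hE] := injE _ _ (submod_incl I) (mklinear gL) (@submod_incl_inj _ _ I).
exists (h (1 : R^o)) => r rI; rewrite -linearZ_LR.
have -> : (r : R) *: (1 : R^o) = submod_incl I (Submod rI) by exact: mulr1.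
by rewrite hE.
Qed.

Section BaerCriterion.
Variables (E A B : lmodType R) (f : {linear A -> B}) (g : {linear A -> E}).
Hypothesis E_baer : baer E.
Hypothesis f_inj : injective f.

Local Open Scope classical_set_scope.

(** A partial linear map is represented by its graph, so that unions of chains are plain unions of
    sets. By linearity, single-valuedness need only be asked over 0. *)
Definition partial_extension (G : set (B * E)) : Prop :=
  [/\ forall a, G (f a, g a),
      forall k x y, G x -> G y -> G (k *: x.1 + y.1, k *: x.2 + y.2)
    & forall e, G (0, e) -> e = 0].

Lemma partial_extension_graph :
  partial_extension [set x | exists a, x = (f a, g a)].
Proof.
split=> [a|k _ _ [u ->] [v ->]|e [u [fu ->]]]; first by exists a.
  by exists (k *: u + v); rewrite /= !linearP.
suff -> : u = 0 by rewrite linear0.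
by apply: f_inj; rewrite linear0.
Qed.

Lemma maximal_partial_extension : exists2 G, partial_extension G &
  forall G', partial_extension G' -> G `<=` G' -> G' `<=` G.
Proof.
(* The guard [G !=set0] accommodates the empty chain, whose union is empty and thus not a partial
   extension. *)
have [|G [PG Gmax]] := @Zorn_bigcup (B * E)%type
    (fun G => G !=set0 -> partial_extension G).
  move=> F FP Ftot [x [G FG Gx]].
  have PG : partial_extension G by apply: FP => //; exists x.
  have step (X Y : set (B * E)) y z : F X -> F Y -> X y -> Y z ->
      exists Z, [/\ F Z, partial_extension Z, Z y & Z z].
    move=> FX FY Xy Yz; have [XY|YX] := Ftot _ _ FX FY.
      by exists Y; split=> //; [apply: FP => //; exists z|exact: XY].
    by exists X; split=> //; [apply: FP => //; exists y|exact: YX].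
  case: (PG) => fg _ _; split=> [u|k y z [Y FY Yy] [Z FZ Zz]|e [Y FY Ye]].
  - by exists G.
  - have [W [FW [_ WP _] Wy Wz]] := step _ _ _ _ FY FZ Yy Zz.
    by exists W => //; apply: WP.
  - have [W [FW [_ _ We] W0 _]] := step _ _ _ _ FY FY Ye Ye.
    exact: We.
have G0 : G !=set0.
  apply: contrapT => G0; apply: (Gmax [set x | exists u, x = (f u, g u)]).
    split=> [x Gx|sub]; first by case: G0; exists x.
    by case: G0; exists (f 0, g 0); apply: sub; exists 0.
  by move=> _; exact: partial_extension_graph.
exists G; first exact: PG.
move=> G' PG' GG'; apply: contrapT => G'G.
by apply: (Gmax G').
Qed.

Lemma baer_extension : exists h : {linear B -> E}, forall x, h (f x) = g x.
Proof.
have [G [Gfg GP G0] Gmax] := maximal_partial_extension.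
have G00 : G (0, 0) by have := Gfg 0; rewrite !linear0.
have GZ k x : G x -> G (k *: x.1, k *: x.2).
  by move=> Gx; have := GP k _ _ Gx G00; rewrite /= !addr0.
have GD x y : G x -> G y -> G (x.1 + y.1, x.2 + y.2).
  by move=> Gx Gy; have := GP 1 _ _ Gx Gy; rewrite !scale1r.
have Guniq b e e' : G (b, e) -> G (b, e') -> e = e'.
  move=> be be'; apply/eqP; rewrite -subr_eq0; apply/eqP/G0.
  by have := GP (-1) _ _ be' be; rewrite /= !scaleN1r addNr addrC.
have Gtotal b : exists e, G (b, e).
  have Ic : prop_submod_closed (fun r : R^o => exists e, G ((r : R) *: b, e)).
    split=> [|r s [e re] [e' se']|k r [e re]].
    - by exists 0; rewrite scale0r.
    - by exists (e + e'); rewrite scalerDl; exact: (GD _ _ re se').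
    - exists (k *: e); rewrite -[k *: r]/((k : R) * r) -scalerA.
      exact: (GZ _ _ re).
  have [phi phiE] : exists phi : R^o -> E,
      forall r, r \in mksubmod Ic -> G ((r : R) *: b, phi r).
    have : forall r : R^o, exists e, r \in mksubmod Ic -> G ((r : R) *: b, e).
      move=> r; have [/mem_mksubmod[e re]|rI] := boolP (r \in mksubmod Ic).
        by exists e.
      by exists 0.
    by case/choice=> phi phiE; exists phi.
  (* [Ic] is the ideal of those r for which r b is already in the domain. The multiplier [e0] is a
     value at [b] compatible with all of these, so adjoining (b, e0) keeps the graph
     single-valued. *)
  have [||e0 e0E] := E_baer (I := mksubmod Ic) (g := phi).
  - move=> r s rI sI; have rsI : r + s \in mksubmod Ic by rewrite rpredD.
    apply: Guniq (phiE _ rsI) _.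
    by rewrite scalerDl; exact: (GD _ _ (phiE _ rI) (phiE _ sI)).
  - move=> k r rI; have krI : k *: r \in mksubmod Ic by rewrite rpredZ.
    apply: Guniq (phiE _ krI) _.
    rewrite -[k *: r]/((k : R) * r) -scalerA.
    exact: (GZ _ _ (phiE _ rI)).
  exists e0; pose G' := [set x | exists r y, G y /\
    x = (y.1 + r *: b, y.2 + r *: e0)].
  apply: (Gmax G'); last 1 first.
  - by exists 1, (0, 0); rewrite /= !add0r !scale1r.
  - split=> [u|k _ _ [r [x [Gx ->]]] [s [y [Gy ->]]]|e [r [[b' e'] [Gy [b0 ->]]]]] /=.
    + by exists 0, (f u, g u); rewrite /= !scale0r !addr0.
    + exists (k * r + s), (k *: x.1 + y.1, k *: x.2 + y.2); split; first exact: GP.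
      by congr pair; rewrite /= scalerDr scalerDl -scalerA addrACA.
    + have b'E : b' = - (r *: b) by apply/eqP; rewrite -addr_eq0 -b0.
      have Gr : G (r *: b, - e').
        by have := GZ (-1) _ Gy; rewrite /= !scaleN1r b'E opprK.
      have rI : (r : R^o) \in mksubmod Ic by apply/mem_mksubmod; exists (- e').
      by rewrite -e0E // -(Guniq _ _ _ Gr (phiE _ rI)) subrr.
  - by move=> [b' e'] Gx; exists 0, (b', e'); rewrite /= !scale0r !addr0.
have [h hG] := choice Gtotal.
have hL : linear h.
  by move=> k x y; apply: Guniq (hG _) _; exact: (GP _ _ _ (hG x) (hG y)).
by exists (mklinear hL) => x; apply: Guniq (hG _) (Gfg x).
Qed.

End BaerCriterion.

Lemma baer_injective (E : lmodType R) : baer E -> injective_module E.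
Proof. by move=> bE A B f g f_inj; apply: baer_extension. Qed.

Lemma prod_injective (E F : lmodType R) :
  injective_module E -> injective_module F -> injective_module (E * F)%type.
Proof.
move=> injE injF A B f g f_inj.
have g1L : linear (fun x => (g x).1) by move=> r u v; rewrite linearP.
have g2L : linear (fun x => (g x).2) by move=> r u v; rewrite linearP.
have [h1 h1E] := injE _ _ f (mklinear g1L) f_inj.
have [h2 h2E] := injF _ _ f (mklinear g2L) f_inj.
have hL : linear (fun y => (h1 y, h2 y)).
  by move=> r u v; rewrite !linearP.
by exists (mklinear hL) => x; rewrite /= h1E h2E /=; case: (g x).
Qed.

End Injective.

(** * The torsion functor preserves injective modules *)

Section TorsionInjective.
Local Open Scope ring_scope.
Variables (R : comPzRingType) (a : ideal R).
Hypothesis R_noetherian : noetherian R.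

(* Artin-Rees for a principal ideal: the chains [J : g^k] and [Ann (g^k e)]
   stabilize, so that [J] meets [<g^k>] inside the annihilator of [e]. *)
Lemma kill_generator (E : lmodType R) (e : E) (J : ideal R) (g : R) :
  injective_module E ->
  (forall r : R^o, r \in J -> exists n, g ^+ n *: ((r : R) *: e) = 0) ->
  exists e', (forall r : R^o, r \in J -> (r : R) *: e' = (r : R) *: e) /\
    exists n, g ^+ n *: e' = 0.
Proof.
move=> injE Je.
have Jc k : prop_submod_closed (fun s : R^o => ((s : R) * g ^+ k : R^o) \in J).
  split=> [|r s rJ sJ|c r rJ]; first by rewrite mul0r rpred0.
    by rewrite mulrDl rpredD.
  by rewrite -[c *: r]/((c : R) * r) -mulrA (submodZ c rJ).
have [|k1 Jk] := @noetherian_acc R R^o (fun k => mksubmod (Jc k)) R_noetherian.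
  move=> k s /mem_mksubmod sJ; apply/mem_mksubmod.
  by rewrite exprS mulrCA (submodZ g sJ).
have [|k2 Ak] := @noetherian_acc R R^o (fun k => annel (g ^+ k *: e)) R_noetherian.
  move=> k s /mem_mksubmod sJ; apply/mem_mksubmod.
  by rewrite exprS -scalerA scalerA mulrC -scalerA sJ scaler0.
pose k := maxn k1 k2.
(* Let r = s g^k lie in [J]. The first chain gives that s g^k1 lies in [J], so a further power of
   [g] kills s g^k1 e. The second chain then gives s g^k2 e = 0. *)
have Jg (r : R^o) : r \in J -> r \in genmod [:: (g ^+ k : R^o)] -> (r : R) *: e = 0.
  move=> rJ /genmod_cons[s [_ /genmod_nil-> rE]].
  have {}rE : r = s * g ^+ k by rewrite rE addr0.
  have sJ : (s : R^o) \in mksubmod (Jc k1).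
    by apply: (Jk k); apply/mem_mksubmod; rewrite -rE.
  have [l sl] := Je _ (proj1 (mem_mksubmod _ _) sJ).
  have : (s : R^o) \in annel (g ^+ k2 *: e).
    apply: (Ak (l + k1)%N); apply/mem_mksubmod.
    by rewrite -sl !scalerA exprD mulrCA mulrA.
  move/mem_mksubmod => sk2.
  rewrite rE -(subnKC (leq_maxr k1 k2 : k2 <= k)%N) exprD mulrA mulrC.
  by rewrite -!scalerA sk2 scaler0.
have gL : linear (fun r : submod J => (submod_val r : R) *: e).
  by move=> c r s; rewrite scalerDl -scalerA.
(* By [Jg], the map r -> r e on [J] descends to the image of [J] in R / <g^k>. The new element is
   the value at the class of 1 of an extension, and is therefore killed by g^k. *)
have [|h hE] := @injective_extension R E _ _
  (comp_map (quot_map (genmod [:: (g ^+ k : R^o)])) (submod_incl J))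
  (mklinear gL) injE.
  by move=> [r rJ] /quot_map_eq0 rg; apply: Jg.
exists (h (quot_map _ (1 : R^o))); split=> [r rJ|].
  by rewrite -!linearZ_LR -[r in RHS]/(submod_val (Submod rJ)) -[RHS]hE /=
    -[r in RHS]mulr1.
exists k; rewrite -!linearZ_LR; set q := quot_map _ _.
suff -> : q = 0 by rewrite linear0.
apply/quot_map_eq0/mem_genmod.
by rewrite -[_ *: _]/(g ^+ k * 1) mulr1 mem_head.
Qed.

(** Baer's criterion gives a multiplier [e0] in [E], possibly not torsion. It is corrected for one
    generator of [a] after another, with its action on [I] unchanged, until all of them act
    nilpotently on it. *)
Lemma torsion_injective (E : lmodType R) :
  injective_module E -> injective_module (submod (torsion a E)).
Proof.
move=> injE; apply: baer_injective => I g gD gZ.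
have [||e0 e0E] := injective_baer injE (I := I) (g := fun r => submod_val (g r)).
- by move=> r s rI sI; rewrite gD.
- by move=> k r rI; rewrite gZ.
have [G aG] := R_noetherian a.
have [e [eI eG]] : exists e : E, (forall r : R^o, r \in I -> (r : R) *: e = (r : R) *: e0) /\
    forall i : R^o, i \in G -> exists n, (i : R) ^+ n *: e = 0.
  have : forall i, i \in G -> i \in a by move=> i /mem_genmod; rewrite aG.
  elim: {aG}G => [|i G IH] Ga; first by exists e0.
  have [|e [eI eG]] := IH; first by move=> j jG; apply: Ga; rewrite in_cons jG orbT.
  (* Adding [Ann e] to the ideal keeps the earlier generators nilpotent. *)
  have Jc : prop_submod_closed (fun r : R^o => exists2 s, s \in I &
      ((r - s) : R) *: e = 0).
    split=> [|r r' [s sI rs] [s' s'I rs']|k r [s sI rs]].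
    - by exists 0; rewrite ?rpred0 // subrr scale0r.
    - exists (s + s'); first exact: rpredD.
      by rewrite opprD addrACA scalerDl rs rs' addr0.
    - exists (k *: s); first exact: rpredZ.
      by rewrite -scalerBr -[k *: _]/((k : R) * _) -scalerA rs scaler0.
  have [|e' [e'J [n ne']]] := @kill_generator E e (mksubmod Jc) i injE.
    move=> r /mem_mksubmod[s sI rs].
    have -> : (r : R) *: e = (s : R) *: e0.
      by rewrite -eI //; apply/eqP; rewrite -subr_eq0 -scalerBl rs.
    rewrite -e0E //; have := submodP (g s) => /(torsionP _ _ R_noetherian).
    by apply; apply: Ga; rewrite mem_head.
  exists e'; split=> [r rI|j].
    rewrite -eI // e'J //; apply/mem_mksubmod; exists r => //.
    by rewrite subrr scale0r.
  rewrite in_cons => /orP[/eqP->|/eG[m me]]; first by exists n.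
  exists m; rewrite (e'J ((j : R) ^+ m)) //; apply/mem_mksubmod; exists 0.
    exact: rpred0.
  by rewrite subr0.
have eT : e \in torsion a E by exact: torsion_nilpotent_generators aG eG.
exists (Submod eT) => r rI; apply: val_inj => /=.
by rewrite e0E // eI.
Qed.

End TorsionInjective.

(** * Q/Z is injective over the integers and separates points *)

Section DivisibleGroup.
Local Open Scope ring_scope.

Lemma divisible_baer (D : lmodType int) :
  (forall (n : nat) (d : D), (0 < n)%N -> exists d', d = (n : int) *: d') ->
  baer D.
Proof.
move=> D_div I g gD gZ.
have [[r rI r0]|I0] := EM (exists2 r : int^o, r \in I & r <> 0); last first.
  exists 0 => r rI; rewrite scaler0; apply: contrapT => gr0.
  apply: I0; exists r => // r0; apply: gr0.
  by rewrite r0 -[0](scale0r (0 : int^o)) gZ ?scale0r ?rpred0.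
have exn : exists n, (0 < n)%N && ((n : int^o) \in I).
  exists `|r|%N; apply/andP; split; first by rewrite absz_gt0; apply/eqP.
  by rewrite abszE; case: (intP r) rI => // n; rewrite ?normrN //= => /submodN; rewrite opprK.
case: (ex_minnP exn) => n /andP[n_gt0 nI] nmin.
have [d' d'E] := D_div n (g (n : int^o)) n_gt0.
exists d' => {r0}r {}rI.
suff rE : r = (r %/ n)%Z *: (n : int^o) by rewrite rE gZ // d'E scalerA.
have: (r %% n)%Z = 0; last first.
  by move=> rn; rewrite [LHS](divz_eq r n) rn addr0.
have: ((r %% n)%Z : int^o) \in I.
  have -> : (r %% n)%Z = r - (r %/ n)%Z *: (n : int^o) by [].
  by rewrite submodB ?rpredZ.
have := @ltz_mod r n; have := @modz_ge0 r n.
rewrite -lt0n n_gt0 => /(_ isT) + /(_ isT).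
case: (r %% n)%Z => // -[//|k] _ kn kI.
have := nmin k.+1; rewrite kI /= => /(_ isT).
by rewrite leqNgt; move: kn; rewrite ltz_nat => ->.
Qed.

Lemma additive_int_linear (A B : lmodType int) (f : A -> B) :
  {morph f : x y / x - y} -> linear f.
Proof.
move=> fB; have f0 : f 0 = 0 by rewrite -(subrr 0) fB subrr.
have fN x : f (- x) = - f x by rewrite -[- x]add0r fB f0 add0r.
have fD x y : f (x + y) = f x + f y by rewrite -{1}[y]opprK fB fN opprK.
move=> k x y; rewrite fD -[k]intz !scaler_int; congr (_ + _).
suff fn n : f (x *+ n) = f x *+ n.
  by case: k => n; rewrite ?NegzE ?mulrNz ?fN -!pmulrn fn.
by elim: n => [|n IH]; rewrite ?mulr0n ?f0 // !mulrS fD IH.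
Qed.

Fact int_rat_closed :
  prop_submod_closed (fun q : ssrint.zmodule rat => exists n : int, q = n%:~R :> rat).
Proof.
split=> [|_ _ [m ->] [n ->]|k _ [n ->]]; first by exists 0.
  by exists (m + n); rewrite intrD.
by exists (n * k); rewrite scalezrE -mulrzA.
Qed.
Definition QmodZ : lmodType int := quotmod (mksubmod int_rat_closed).

Lemma QmodZ_injective : injective_module QmodZ.
Proof.
apply/baer_injective/divisible_baer => n d n_gt0.
have [q ->] := quot_map_surj d.
exists (quot_map _ ((q : rat) / n%:R : ssrint.zmodule rat)); rewrite -linearZ_LR scalezrE.
by rewrite -mulrzl mulrCA -pmulrn divff ?mulr1 ?pnatr_eq0 -?lt0n.
Qed.

(** With [n] the order of [m], the assignment k m -> k / n is well defined and extends to [M]; it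
    sends [m] to the class of 1 / n, which is nonzero. *)
Lemma QmodZ_separates (M : lmodType int) (m : M) :
  m <> 0 -> exists phi : {linear M -> QmodZ}, phi m <> 0.
Proof.
move=> m0.
have [n n_gt1 nm] : exists2 n : nat, (1 < n)%N &
    forall k : int, k *: m = 0 -> (n %| k)%Z.
  have [exn|nn] := EM (exists n : nat, (0 < n)%N && ((n : int) *: m == 0)).
    case: (ex_minnP exn) => n /andP[n_gt0 /eqP nm] nmin.
    exists n => [|k km].
      by case: n n_gt0 nm {nmin} => [|[|]] //; rewrite scale1r.
    apply/dvdz_mod0P; have: (k %% n)%Z *: m = 0.
      by rewrite /modz scalerBl km -scalerA nm scaler0 subrr.
    have := @ltz_mod k n; have := @modz_ge0 k n.
    rewrite -lt0n n_gt0 => /(_ isT) + /(_ isT).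
    case: (k %% n)%Z => // -[//|j] _ jn jm.
    have := nmin j.+1; rewrite jm eqxx /= => /(_ isT).
    by rewrite leqNgt; move: jn; rewrite ltz_nat => ->.
  (* Here [m] has infinite order, and any integer above 1 would do. *)
  exists 2%N => // k km; suff -> : k = 0 by [].
  apply: contrapT => k0; apply: nn; exists `|k|%N.
  rewrite absz_gt0; apply/andP; split; apply/eqP => //.
  by case: (intP k) km => // n; rewrite ?abszN //= scaleNr => /eqP; rewrite oppr_eq0 => /eqP.
pose q : QmodZ := quot_map _ ((n%:R^-1 : rat) : ssrint.zmodule rat).
have dL (N : lmodType int) (x : N) : linear (fun k : int^o => (k : int) *: x).
  by move=> k i j; rewrite scalerDl -scalerA.
have [|h hE] := @injective_extension _ QmodZ _ _ (mklinear (dL _ m)) (mklinear (dL _ q))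
  QmodZ_injective.
  move=> k /nm /dvdzP[j kE] /=; rewrite -linearZ_LR scalezrE.
  apply/quot_map_eq0/mem_mksubmod; exists j.
  have nV : (n%:R^-1 : rat) *~ n = 1.
    by rewrite -mulrzl -pmulrn divff // pnatr_eq0 -lt0n ltnW.
  by rewrite kE mulrC mulrzA nV.
exists h => hm; have := hE 1; rewrite /= !scale1r hm => /esym/quot_map_eq0.
move/mem_mksubmod => [j jE].
have : 0 < (j%:~R : rat) < 1.
  by rewrite -jE invr_gt0 invf_lt1 ?ltr0n ?ltr1n ?(ltnW n_gt1).
rewrite ltr0z ltrz1; case: j {jE} => // -[|j] //.
Qed.

End DivisibleGroup.

(** * Every module embeds into an injective one *)

Section EnoughInjectives.
Local Open Scope ring_scope.
Variable R : comPzRingType.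

(* [S -> Hom_Z (R, Q/Z)], an [S]-fold product of copies of the coinduced
   module. *)
Record coind (S : Type) : Type := Coind {
  coind_fun :> S -> R -> QmodZ;
  coindD : forall s, {morph coind_fun s : r r' / r + r'} }.

Section CoindModule.
Variable S : Type.
Implicit Types f g h : coind S.

HB.instance Definition _ := gen_eqMixin (coind S).
HB.instance Definition _ := gen_choiceMixin (coind S).

Lemma coind_ext f g : (forall s r, f s r = g s r) -> f = g.
Proof.
case: f g => [f fD] [g gD] /= fg.
have {}fg : f = g by apply/funext => s; apply/funext.
by subst g; rewrite (Prop_irrelevance fD gD).
Qed.

Fact coind_zeroD (s : S) : {morph (fun _ : R => 0 : QmodZ) : r r' / r + r'}.
Proof. by move=> r r'; rewrite addr0. Qed.
Definition coind_zero := Coind coind_zeroD.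

Fact coind_oppD f (s : S) : {morph (fun r => - f s r) : r r' / r + r'}.
Proof. by move=> r r'; rewrite coindD opprD. Qed.
Definition coind_opp f := Coind (coind_oppD f).

Fact coind_addD f g (s : S) : {morph (fun r => f s r + g s r) : r r' / r + r'}.
Proof. by move=> r r'; rewrite !coindD addrACA. Qed.
Definition coind_add f g := Coind (coind_addD f g).

Fact coind_scaleD k f (s : S) : {morph (fun r => f s (r * k)) : r r' / r + r'}.
Proof. by move=> r r'; rewrite mulrDl coindD. Qed.
Definition coind_scale k f := Coind (coind_scaleD k f).

Fact coind_addA : associative coind_add.
Proof. by move=> f g h; apply: coind_ext => s r /=; rewrite addrA. Qed.
Fact coind_addC : commutative coind_add.
Proof. by move=> f g; apply: coind_ext => s r /=; rewrite addrC. Qed.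
Fact coind_add0 : left_id coind_zero coind_add.
Proof. by move=> f; apply: coind_ext => s r /=; rewrite add0r. Qed.
Fact coind_addN : left_inverse coind_zero coind_opp coind_add.
Proof. by move=> f; apply: coind_ext => s r /=; rewrite addNr. Qed.
HB.instance Definition _ :=
  GRing.isZmodule.Build (coind S) coind_addA coind_addC coind_add0 coind_addN.

Fact coind_scaleA j k f : coind_scale j (coind_scale k f) = coind_scale (j * k) f.
Proof. by apply: coind_ext => s r /=; rewrite mulrA. Qed.
Fact coind_scale1 : left_id 1 coind_scale.
Proof. by move=> f; apply: coind_ext => s r /=; rewrite mulr1. Qed.
Fact coind_scaleDr : right_distributive coind_scale +%R.
Proof. by move=> k f g; apply: coind_ext. Qed.
Fact coind_scaleDl f : {morph coind_scale^~ f : j k / j + k}.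
Proof. by move=> j k; apply: coind_ext => s r /=; rewrite mulrDr coindD. Qed.
HB.instance Definition _ := GRing.Zmodule_isLmodule.Build R (coind S)
  coind_scaleA coind_scale1 coind_scaleDr coind_scaleDl.

(** Evaluation at 1 turns [R]-linear maps into Hom_Z(R, Q/Z) into additive maps to Q/Z. These extend
    for each [s] by injectivity of Q/Z, and r -> h s (r y) returns to the coinduced module. *)
Lemma coind_injective : injective_module (coind S).
Proof.
move=> A B f g f_inj.
have fL : linear (f : ssrint.zmodule A -> ssrint.zmodule B).
  by apply: additive_int_linear => x y; rewrite linearB.
have ext s : exists h : {linear ssrint.zmodule B -> QmodZ},
    forall x : A, h (f x) = g x s 1.
  have gL : linear ((fun x : A => g x s 1) : ssrint.zmodule A -> QmodZ).
    apply: additive_int_linear => x y.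
    by rewrite linearB.
  have [h hE] := @QmodZ_injective (ssrint.zmodule A) (ssrint.zmodule B)
    (mklinear fL) (mklinear gL) f_inj.
  by exists h => x; exact: hE.
have [h hE] := choice ext.
have hD y s : {morph (fun r : R => h s (r *: y)) : r r' / r + r'}.
  by move=> r r'; rewrite scalerDl linearD.
have hL : linear (fun y => Coind (hD y)).
  move=> k x y; apply: coind_ext => s r.
  by rewrite /= scalerDr scalerA linearD.
exists (mklinear hL) => x; apply: coind_ext => s r.
by rewrite /= -linearZ_LR hE linearZ_LR /= mul1r.
Qed.

End CoindModule.

Lemma enough_injectives (M : lmodType R) :
  exists E : lmodType R, injective_module E /\
    exists eta : {linear M -> E}, injective eta.
Proof.
exists (coind {linear ssrint.zmodule M -> QmodZ}).
split; first exact: coind_injective.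
have eD m (phi : {linear ssrint.zmodule M -> QmodZ}) :
    {morph (fun r : R => phi (r *: m)) : r r' / r + r'}.
  by move=> r r'; rewrite scalerDl linearD.
have eL : linear (fun m : M => Coind (eD m)).
  by move=> k x y; apply: coind_ext => s r; rewrite /= scalerDr scalerA linearD.
exists (mklinear eL); apply: raddf_inj => m m0.
apply: contrapT => /(@QmodZ_separates (ssrint.zmodule M))[phi]; apply.
have : mklinear eL m phi 1 = 0 by rewrite m0.
by rewrite /= scale1r.
Qed.

End EnoughInjectives.

(** * Injective resolutions and local cohomology *)

Section Resolutions.
Local Open Scope ring_scope.
Variable R : comPzRingType.

Definition resolution (M : lmodType R) (E : cochain R) (eta : {linear M -> E 0}) :=
  [/\ forall i, injective_module (E i), injective eta,
      forall z : E 0, cc_diff E 0 z = 0 <-> exists m, z = eta m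
    & forall i (z : E i.+1),
        cc_diff E i.+1 z = 0 <-> exists y, z = cc_diff E i y].

(** The property [P] is carried along so that torsion modules receive resolutions with torsion
    terms; the constant [True] gives ordinary resolutions. *)
Lemma build_resolution (P : lmodType R -> Prop) :
  (forall (M : lmodType R) (N : submodClosed M), P M -> P (quotmod N)) ->
  (forall M : lmodType R, P M -> exists E : lmodType R,
     [/\ P E, injective_module E & exists eta : {linear M -> E}, injective eta]) ->
  forall M : lmodType R, P M ->
  exists (E : cochain R) (eta : {linear M -> E 0}),
    resolution eta /\ forall i, P (E i).
Proof.
move=> Pquot Penough M PM.
have emb (X : {X : lmodType R | P X}) : {E : {E : lmodType R | P E} &
    {eta : {linear sval X -> sval E} | injective eta /\ injective_module (sval E)}}.
  case: X => X PX; have [E EP] := cid (Penough X PX).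
  have PE : P E by case: EP.
  exists (exist _ E PE); apply: cid => /=.
  by case: EP => _ injE [eta eta_inj]; exists eta.
pose eta (X : {X : lmodType R | P X}) :
  {linear sval X -> sval (projT1 (emb X))} := sval (projT2 (emb X)).
have etaP X : injective (eta X) := proj1 (svalP (projT2 (emb X))).
have injE X : injective_module (sval (projT1 (emb X))) :=
  proj2 (svalP (projT2 (emb X))).
(* [Z n] is the n-th cosyzygy: each one is the cokernel of the chosen embedding of its
   predecessor. *)
pose next (X : {X : lmodType R | P X}) : {X : lmodType R | P X} := exist P
  (quotmod (imgmod (eta X))) (Pquot _ (imgmod (eta X)) (svalP (projT1 (emb X)))).
pose Z := fix Z n := if n is k.+1 then next (Z k) else exist P M PM.
pose d n : {linear sval (projT1 (emb (Z n))) -> sval (projT1 (emb (Z n.+1)))} :=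
  comp_map (eta (Z n.+1)) (quot_map (imgmod (eta (Z n)))).
have d0 n x : d n x = 0 <-> exists y, x = eta (Z n) y.
  split=> [dx|[y ->]]; last first.
    rewrite /d /=; suff -> : quot_proj (imgmod (eta (Z n))) (eta (Z n) y) = 0.
      exact: linear0.
    by apply/quot_map_eq0/mem_mksubmod; exists y.
  have q0 : quot_map (imgmod (eta (Z n))) x = 0.
    by apply: (etaP (Z n.+1)); rewrite linear0.
  by move/quot_map_eq0/mem_mksubmod: q0.
have dd n x : d n.+1 (d n x) = 0.
  by apply/d0; exists (quot_map (imgmod (eta (Z n))) x).
exists (Cochain dd), (eta (Z 0%N)); split; last first.
  by move=> i; exact: (svalP (projT1 (emb (Z i)))).
split=> [i||z|i z]; [exact: injE|exact: etaP|exact: d0|].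
split=> [/d0[q ->]|[y ->]]; last exact: dd.
by have [m ->] := quot_map_surj q; exists m.
Qed.

Lemma injective_resolutionP (M : lmodType R) :
  exists eta : {linear M -> injective_resolution M 0}, resolution eta.
Proof.
suff : injective_resolution_of M (injective_resolution M).
  by case=> injE [eta [? ? ?]]; exists eta.
rewrite /injective_resolution; case: pselect => [exE|nE]; first exact: svalP.
case: nE; have [||E [eta [[? ? ? ?] _]]] := @build_resolution (fun=> True) _ _ M I.
- by [].
- by move=> N _; have [E [? ?]] := enough_injectives N; exists E.
- by exists E; split=> //; exists eta.
Qed.

Definition resolution_map (M : lmodType R) : {linear M -> injective_resolution M 0} :=
  sval (cid (injective_resolutionP M)).

Lemma resolution_mapP (M : lmodType R) : resolution (resolution_map M).
Proof. exact: svalP. Qed.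

Definition chain_map (E F : cochain R) (u : forall i, {linear E i -> F i}) :=
  forall i x, cc_diff F i (u i x) = u i.+1 (cc_diff E i x).

Definition lifting (M N : lmodType R) (E F : cochain R) (eta : {linear M -> E 0})
  (eps : {linear N -> F 0}) (f : {linear M -> N})
  (u : forall i, {linear E i -> F i}) :=
  chain_map u /\ forall m, u 0%N (eta m) = eps (f m).

Lemma lifting_exists (M N : lmodType R) (E F : cochain R) (eta : {linear M -> E 0})
  (eps : {linear N -> F 0}) (f : {linear M -> N}) :
  resolution eta -> resolution eps -> exists u, lifting eta eps f u.
Proof.
move=> [_ eta_inj eta0 Eex] [injF _ eps0 _].
(* Each component is built together with the fact that it preserves cocycles, which is exactly what
   the extension to the next degree requires. *)
pose T i := {u : {linear E i -> F i} |
  forall z, cc_diff E i z = 0 -> cc_diff F i (u z) = 0}.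
have [u0 u0E] := injF 0%N _ _ eta (comp_map eps f) eta_inj.
have u0P z : cc_diff E 0 z = 0 -> cc_diff F 0 (u0 z) = 0.
  by case/eta0=> m ->; rewrite u0E; apply/eps0; exists (f m).
have step i (u : T i) : {v : T i.+1 |
    forall x, sval v (cc_diff E i x) = cc_diff F i (sval u x)}.
  case: u => u uP; apply: cid => /=.
  have [|v vE] := @injective_extension R (F i.+1) _ _ (cc_diff E i)
    (comp_map (cc_diff F i) u) (injF _).
    by move=> x /uP.
  have vP z : cc_diff E i.+1 z = 0 -> cc_diff F i.+1 (v z) = 0.
    by case/Eex=> y ->; rewrite vE; exact: cc_diffK.
  by exists (exist _ v vP).
pose w := fix w i : T i := if i is k.+1 then sval (step k (w k)) else
  exist _ u0 u0P.
exists (fun i => sval (w i)); split=> [i x|m]; last by rewrite /= u0E.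
by rewrite /=; case: (step i (w i)) => v /= ->.
Qed.

(* Two liftings differ by a chain map lifting [0], hence null-homotopic. *)
Lemma lifting_homotopy (M N : lmodType R) (E F : cochain R)
  (eta : {linear M -> E 0}) (eps : {linear N -> F 0}) (f : {linear M -> N}) u v :
  resolution eta -> resolution eps ->
  lifting eta eps f u -> lifting eta eps f v ->
  (exists h : {linear E 1 -> F 0}, forall x, u 0%N x - v 0%N x = h (cc_diff E 0 x)) /\
  forall i, exists (h : {linear E i.+2 -> F i.+1}) (k : {linear E i.+1 -> F i}),
    forall x, u i.+1 x - v i.+1 x = h (cc_diff E i.+1 x) + cc_diff F i (k x).
Proof.
move=> [_ eta_inj eta0 Eex] [injF _ _ _] [uC u0] [vC v0].
have wL i : linear (fun x => u i x - v i x).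
  by move=> c x y; rewrite !linearP addrACA -scalerDr.
pose w i := mklinear (wL i).
have wC i x : cc_diff F i (w i x) = w i.+1 (cc_diff E i x).
  by rewrite /= linearB uC vC.
have [|h0 h0E] := @injective_extension R (F 0%N) _ _ (cc_diff E 0) (w 0%N) (injF _).
  by move=> x /eta0[m ->]; rewrite /= u0 v0 subrr.
have w0 : exists h : {linear E 1 -> F 0}, forall x, w 0%N x = h (cc_diff E 0 x).
  by exists h0 => x; rewrite h0E.
(* The map [h] found in one degree serves as [k] in the next. *)
split=> //; elim=> [|i [h [k hk]]].
  have gL : linear (fun x => w 1%N x - cc_diff F 0 (h0 x)).
    by move=> c x y; rewrite !linearP addrACA -scalerDr.
  have [|h hE] := @injective_extension R (F 1%N) _ _ (cc_diff E 1) (mklinear gL) (injF _).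
    by move=> x /Eex[y ->]; rewrite /= -[_ - _]/(w 1%N _ - _) -wC -h0E subrr.
  by exists h, h0 => x; rewrite hE /= subrK.
have gL : linear (fun x => w i.+2 x - cc_diff F i.+1 (h x)).
  by move=> c x y; rewrite !linearP addrACA -scalerDr.
have [|h' hE] := @injective_extension R (F i.+2) _ _ (cc_diff E i.+2) (mklinear gL) (injF _).
  move=> x /Eex[y ->].
  rewrite -[LHS]/(w i.+2 (cc_diff E i.+1 y) - cc_diff F i.+1 (h (cc_diff E i.+1 y))).
  by rewrite -wC /= hk linearD cc_diffK addr0 subrr.
by exists h', h => x; rewrite hE /= subrK.
Qed.

End Resolutions.

(** * Cohomology classes by representatives, and functoriality *)

Section CohomologyClasses.
Local Open Scope ring_scope.
Variables (R : comPzRingType) (a : ideal R).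

Lemma torsion_linear (A B : lmodType R) (f : {linear A -> B}) x :
  x \in torsion a A -> f x \in torsion a B.
Proof. by move=> xT; exact: (torsion_map_subproof f (Submod xT)). Qed.

(** Classes are handled through representatives in [E i] itself, away from the nested [submod] and
    [quotmod] types of [cohomology]. *)
Definition tcocycle (E : cochain R) i (z : E i) : Prop :=
  z \in torsion a (E i) /\ cc_diff E i z = 0.

Lemma tcocycleP (E : cochain R) i (c : R) (y z : E i) :
  tcocycle y -> tcocycle z -> tcocycle (c *: y + z).
Proof.
move=> [yT y0] [zT z0]; split; first by rewrite rpredD ?rpredZ.
by rewrite linearP y0 z0 scaler0 addr0.
Qed.

Definition tboundary (E : cochain R) i : E i -> Prop :=
  match i with
  | 0 => fun z => z = 0
  | j.+1 => fun z => exists2 y, y \in torsion a (E j) & z = cc_diff E j y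
  end.

Local Notation HH E i := (cohomology (torsion_complex a E) i).

Lemma tcocycle_cocycles (E : cochain R) i (z : E i) (tz : tcocycle z) :
  (Submod tz.1 : torsion_complex a E i) \in cocycles (torsion_complex a E) i.
Proof. by apply/mem_mksubmod; apply: val_inj; case: tz. Qed.

(* The value [0] off the torsion cocycles is junk. *)
Definition hclass (E : cochain R) i (z : E i) : HH E i :=
  if pselect (tcocycle z) is left tz
  then quot_map (coboundaries (torsion_complex a E) i)
         (Submod (tcocycle_cocycles tz))
  else 0.

Lemma hclassE (E : cochain R) i (z : E i) (tz : tcocycle z) :
  hclass z = quot_map (coboundaries (torsion_complex a E) i)
               (Submod (tcocycle_cocycles tz)).
Proof.
rewrite /hclass; case: pselect => // tz'.
by rewrite (Prop_irrelevance tz tz').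
Qed.

Lemma hclass_surj (E : cochain R) i (h : HH E i) :
  exists2 z : E i, tcocycle z & h = hclass z.
Proof.
have [[[z zT] zc] ->] := quot_map_surj h.
have tz : tcocycle z.
  by split=> //; move/mem_mksubmod: (zc) => /(congr1 val).
exists z => //; rewrite hclassE; congr (quot_map _ _).
by apply: val_inj; apply: val_inj.
Qed.

Lemma hclass_eq0 (E : cochain R) i (z : E i) :
  tcocycle z -> hclass z = 0 <-> tboundary z.
Proof.
move=> tz; rewrite hclassE quot_map_eq0 mem_mksubmod.
rewrite /in_coboundaries_cocycles /=.
case: i z tz => [|i] z tz /=.
  by split=> [/(congr1 val)|z0] //; apply: val_inj.
split=> [[[y yT] /(congr1 val) /= zE]|[y yT zE]]; first by exists y.
by exists (Submod (yT : y \in torsion a (E i))); apply: val_inj.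
Qed.

Lemma hclassP (E : cochain R) i (c : R) (y z : E i) :
  tcocycle y -> tcocycle z -> hclass (c *: y + z) = c *: hclass y + hclass z.
Proof.
move=> ty tz; rewrite (hclassE ty) (hclassE tz) (hclassE (tcocycleP c ty tz)).
rewrite -linearP; congr (quot_map _ _).
by apply: val_inj; apply: val_inj.
Qed.

Lemma tcocycle0 (E : cochain R) i : tcocycle (0 : E i).
Proof. by split; rewrite ?rpred0 ?linear0. Qed.

Lemma hclassZ (E : cochain R) i (c : R) (z : E i) :
  tcocycle z -> hclass (c *: z) = c *: hclass z.
Proof.
move=> tz; rewrite -[c *: z]addr0 (hclassP c tz (tcocycle0 E i)).
suff -> : hclass (0 : E i) = 0 by rewrite addr0.
apply/hclass_eq0; first exact: tcocycle0.
by case: i {z tz} => [//|i]; exists 0; rewrite ?rpred0 ?linear0.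
Qed.

Lemma tcocycleB (E : cochain R) i (y z : E i) :
  tcocycle y -> tcocycle z -> tcocycle (y - z).
Proof. by move=> ty tz; rewrite addrC -scaleN1r; apply: tcocycleP. Qed.

Lemma hclass_eq (E : cochain R) i (y z : E i) :
  tcocycle y -> tcocycle z -> hclass y = hclass z <-> tboundary (y - z).
Proof.
move=> ty tz; rewrite -(hclass_eq0 (tcocycleB ty tz)).
rewrite [y - z]addrC -scaleN1r hclassP // scaleN1r addrC.
by split=> [->|/eqP]; rewrite ?subrr // subr_eq0 => /eqP.
Qed.

(** [g] acts between two single degrees and is not part of a chain map, so the lemma covers both
    functorial maps, with [j = i], and connecting maps, with [j = i.+1]. *)
Lemma hclass_map (E F : cochain R) i j (g : {linear E i -> F j}) :
  (forall z, tcocycle z -> cc_diff F j (g z) = 0) ->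
  (forall z, tcocycle z -> tboundary z -> tboundary (g z)) ->
  exists G : {linear HH E i -> HH F j},
    forall z, tcocycle z -> G (hclass z) = hclass (g z).
Proof.
move=> gc gb.
have gt z : tcocycle z -> tcocycle (g z).
  by move=> tz; split; [apply: torsion_linear; case: tz|exact: gc].
have /choice[rep repP] (h : HH E i) : exists z : E i, tcocycle z /\ h = hclass z.
  by have [z ? ?] := hclass_surj h; exists z.
have GE z : tcocycle z -> hclass (g (rep (hclass z))) = hclass (g z).
  move=> tz; have [tr rE] := repP (hclass z).
  apply/(hclass_eq (gt _ tr) (gt _ tz)); rewrite -linearB.
  by apply: gb; [exact: tcocycleB|apply/hclass_eq].
have GL : linear (fun h => hclass (g (rep h))).
  move=> c p q; have [ty yE] := repP p; have [tz zE] := repP q.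
  rewrite {1}yE {1}zE -hclassP // GE; last exact: tcocycleP.
  by rewrite linearP hclassP //; apply: gt.
by exists (mklinear GL) => z tz; exact: GE.
Qed.

Lemma chain_map_tcocycle (E F : cochain R) (u : forall i, {linear E i -> F i}) i z :
  chain_map u -> tcocycle z -> tcocycle (u i z).
Proof.
move=> uC [zT z0]; split; first exact: torsion_linear.
by rewrite uC z0 linear0.
Qed.

Lemma chain_map_tboundary (E F : cochain R) (u : forall i, {linear E i -> F i}) i z :
  chain_map u -> tboundary z -> tboundary (u i z).
Proof.
move=> uC; case: i z => [|i] z /=; first by move=> ->; exact: linear0.
by case=> y yT ->; exists (u i y); [exact: torsion_linear|rewrite uC].
Qed.

Lemma chain_map_hclass (E F : cochain R) (u : forall i, {linear E i -> F i}) i y z :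
  chain_map u -> tcocycle y -> tcocycle z -> hclass y = hclass z ->
  hclass (u i y) = hclass (u i z).
Proof.
move=> uC ty tz /(hclass_eq ty tz) yz.
apply/hclass_eq; try exact: chain_map_tcocycle.
by rewrite -linearB; apply: chain_map_tboundary.
Qed.

Lemma lifting_hclass (M N : lmodType R) (E F : cochain R)
  (eta : {linear M -> E 0}) (eps : {linear N -> F 0}) (f : {linear M -> N}) u v i z :
  resolution eta -> resolution eps ->
  lifting eta eps f u -> lifting eta eps f v -> tcocycle z ->
  hclass (u i z) = hclass (v i z).
Proof.
move=> rE rF lu lv tz.
have [[h0 h0E] hS] := lifting_homotopy rE rF lu lv.
apply/hclass_eq; try exact: chain_map_tcocycle lu.1 tz.
  exact: chain_map_tcocycle lv.1 tz.
case: i z tz => [|i] z [zT z0]; first by rewrite h0E z0 linear0.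
have [h [k hk]] := hS i; rewrite hk z0 linear0 add0r.
by exists (k z) => //; exact: torsion_linear.
Qed.

Lemma lifting_id (M : lmodType R) (E : cochain R) (eta : {linear M -> E 0}) :
  lifting eta eta (scale_map M 1) (fun i => scale_map (E i) 1).
Proof. by split=> [i x|m] /=; rewrite !scale1r. Qed.

Lemma lifting_scale (M : lmodType R) (E : cochain R) (eta : {linear M -> E 0}) r :
  lifting eta eta (scale_map M r) (fun i => scale_map (E i) r).
Proof. by split=> [i x|m] /=; rewrite linearZ_LR. Qed.

Lemma lifting_comp (M N L : lmodType R) (E F G : cochain R) (eta : {linear M -> E 0})
  (eps : {linear N -> F 0}) (phi : {linear L -> G 0})
  (f : {linear M -> N}) (g : {linear N -> L}) u v :
  lifting eta eps f u -> lifting eps phi g v ->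
  lifting eta phi (comp_map g f) (fun i => comp_map (v i) (u i)).
Proof.
by move=> [uC u0] [vC v0]; split=> [i x|m] /=; rewrite ?vC ?uC // u0 v0.
Qed.

Lemma local_cohomology_map_exists (M N : lmodType R) (f : {linear M -> N}) i :
  exists G : {linear local_cohomology a i M -> local_cohomology a i N},
  forall u, lifting (resolution_map M) (resolution_map N) f u ->
  forall z, tcocycle z -> G (hclass z) = hclass (u i z).
Proof.
have [rM rN] := (resolution_mapP M, resolution_mapP N).
have [v lv] := lifting_exists f rM rN.
have [|z _|G GE] := @hclass_map _ _ i i (v i).
- by move=> z [_ z0]; rewrite lv.1 z0 linear0.
- exact: chain_map_tboundary lv.1.
exists G => u lu z tz; rewrite GE //.
exact: lifting_hclass rM rN lv lu tz.
Qed.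

Definition local_cohomology_map (M N : lmodType R) (f : {linear M -> N}) i :
  {linear local_cohomology a i M -> local_cohomology a i N} :=
  sval (cid (local_cohomology_map_exists f i)).

Lemma local_cohomology_mapE (M N : lmodType R) (f : {linear M -> N}) u i z :
  lifting (resolution_map M) (resolution_map N) f u -> tcocycle z ->
  local_cohomology_map f i (hclass z) = hclass (u i z).
Proof. by move=> lu tz; apply: (svalP (cid (local_cohomology_map_exists f i))). Qed.

Lemma lifting_ext (M N : lmodType R) (E F : cochain R) (eta : {linear M -> E 0})
  (eps : {linear N -> F 0}) (f g : {linear M -> N}) u :
  f =1 g -> lifting eta eps f u -> lifting eta eps g u.
Proof. by move=> fg [uC u0]; split=> // m; rewrite u0 fg. Qed.

(** The composite of liftings and multiplication by [r] lift the same map, hence agree on classes.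
    With [r = 1] this transports cohomology along isomorphisms; otherwise it factors multiplication
    by [x] on cohomology through that of xN. *)
Lemma local_cohomology_map_scale (M N : lmodType R) (f : {linear M -> N})
  (g : {linear N -> M}) (r : R) i h : (forall m, g (f m) = r *: m) ->
  local_cohomology_map g i (local_cohomology_map f i h) = r *: h.
Proof.
move=> gf; have [rM rN] := (resolution_mapP M, resolution_mapP N).
have [u lu] := lifting_exists f rM rN; have [v lv] := lifting_exists g rN rM.
have [z tz ->] := hclass_surj h.
rewrite (local_cohomology_mapE lu tz) (local_cohomology_mapE lv); last first.
  exact: chain_map_tcocycle lu.1 tz.
rewrite -hclassZ //; have lvu := lifting_comp lu lv.
apply: (lifting_hclass rM rM lvu _ tz (v := fun i => scale_map _ r)).
by apply: lifting_ext (lifting_scale _ r) => m; rewrite /= gf.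
Qed.

Lemma local_cohomology_torsion (M : lmodType R) i (h : local_cohomology a i M) r :
  (r : R^o) \in a -> exists n, r ^+ n *: h = 0.
Proof.
move=> ra; have [z tz ->] := hclass_surj h.
have /mem_mksubmod[t zt] := tz.1; exists t; rewrite -hclassZ //.
rewrite zt; last exact: (idpow_expr t ra).
by rewrite -(scale0r z) hclassZ // scale0r.
Qed.

End CohomologyClasses.

(** * The long exact sequence *)

Section LongExactSequence.
Local Open Scope ring_scope.
Variables (R : comPzRingType) (a : ideal R).

Section Cone.
Variables (E F : cochain R) (u : forall i, {linear E i -> F i}).
Hypothesis uC : chain_map u.

Definition cone_obj n : lmodType R :=
  if n is k.+1 then (E k.+1 * F k)%type else E 0.

Fact cone_diff0_linear : linear (fun x : E 0 => (cc_diff E 0 x, u 0%N x)).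
Proof. by move=> c x y; rewrite !linearP. Qed.

Fact cone_diffS_linear n : linear (fun x : (E n.+1 * F n)%type =>
  (cc_diff E n.+1 x.1, u n.+1 x.1 - cc_diff F n x.2)).
Proof. by move=> c x y; rewrite /= !linearP addrACA -scalerDr. Qed.

Definition cone_diff n : {linear cone_obj n -> cone_obj n.+1} :=
  if n is k.+1 return {linear cone_obj n -> cone_obj n.+1}
  then mklinear (@cone_diffS_linear k) else mklinear cone_diff0_linear.

Fact cone_diffK n x : cone_diff n.+1 (cone_diff n x) = 0.
Proof.
case: n x => [|n] x /=; congr pair; rewrite ?cc_diffK //.
  by rewrite uC subrr.
by rewrite linearB cc_diffK subr0 uC subrr.
Qed.

Definition cone : cochain R := Cochain cone_diffK.

Definition cone_proj n : {linear cone n -> E n} :=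
  match n return {linear cone n -> E n} with
  | 0 => mklinear (fun c x y => erefl : (id : E 0 -> E 0) (c *: x + y) = c *: id x + id y)
  | k.+1 => mklinear (fun c x y => erefl :
      (fst : E k.+1 * F k -> E k.+1) (c *: x + y) = c *: x.1 + y.1)
  end.

Fact cone_inj_linear n : linear (fun y : F n => ((0, y) : cone n.+1)).
Proof. by move=> c x y; congr pair; rewrite /= scaler0 addr0. Qed.
Definition cone_inj n : {linear F n -> cone n.+1} := mklinear (@cone_inj_linear n).

Lemma cone_proj_chain_map : chain_map cone_proj.
Proof. by case. Qed.

Lemma torsion_pair (M N : lmodType R) (x : M) (y : N) :
  x \in torsion a M -> y \in torsion a N -> (x, y) \in torsion a (M * N)%type.
Proof.
move=> /mem_mksubmod[s xs] /mem_mksubmod[t yt]; apply/mem_mksubmod.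
exists (maxn s t) => r rst; congr pair; [apply: xs|apply: yt].
  exact: idpow_desc (leq_maxl s t) _ rst.
exact: idpow_desc (leq_maxr s t) _ rst.
Qed.

Lemma torsion_fst (M N : lmodType R) (p : (M * N)%type) :
  p \in torsion a (M * N)%type -> p.1 \in torsion a M.
Proof.
by move=> /mem_mksubmod[s ps]; apply/mem_mksubmod; exists s => r /ps/(congr1 fst).
Qed.

Lemma torsion_snd (M N : lmodType R) (p : (M * N)%type) :
  p \in torsion a (M * N)%type -> p.2 \in torsion a N.
Proof.
by move=> /mem_mksubmod[s ps]; apply/mem_mksubmod; exists s => r /ps/(congr1 snd).
Qed.

(** If u x = d y with [y] torsion, then (x, y) is the required cocycle of the cone. *)
Lemma cone_exact_proj n (x : E n) : tcocycle a x -> tboundary a (u n x) ->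
  exists2 z : cone n, tcocycle a z & cone_proj n z = x.
Proof.
case: n x => [|n] x [xT x0].
  by move=> ux; exists x => //; split=> //; congr pair; rewrite ?x0.
case=> y yT ux; exists (x, y) => //; split; first exact: torsion_pair.
by congr pair; rewrite //= ux subrr.
Qed.

Lemma cone_exact_inj n (y : F n) : tcocycle a y -> tboundary a (cone_inj n y) ->
  exists2 x : E n, tcocycle a x & tboundary a (y - u n x).
Proof.
case: n y => [|n] y [yT y0].
  case=> x xT [dx ux]; exists x => //.
  by rewrite ux subrr.
case=> -[x z] /[dup]/torsion_fst xT /torsion_snd zT [dx ux]; exists x => //.
by rewrite ux addrC addKr; exists (- z); rewrite ?linearN ?submodN.
Qed.

(** If z = (x, y) with x = d x0, subtracting the boundary (d x0, u x0) of (x0, 0) leaves (0, y - u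
    x0). *)
Lemma cone_exact_res n (z : cone n.+1) :
  tcocycle a z -> tboundary a (cone_proj n.+1 z) ->
  exists2 y : F n, tcocycle a y & tboundary a (z - cone_inj n y).
Proof.
case: z => x y [/[dup]/torsion_fst/= xT /torsion_snd/= yT [dx uxy]] [x0 x0T /= xE].
exists (y - u n x0).
  split; first by rewrite submodB // torsion_linear.
  by rewrite linearB uC -xE; apply/eqP; rewrite -oppr_eq0 opprB uxy.
case: n x y xT yT dx uxy x0 x0T xE => [|n] x y xT yT dx uxy x0 x0T xE.
  exists x0 => //; congr pair; first by rewrite /= subr0.
  by rewrite /= opprB addrC subrK.
exists (x0, 0); first by rewrite torsion_pair ?rpred0.
congr pair; first by rewrite /= subr0.
by rewrite /= linear0 subr0 opprB addrC subrK.
Qed.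

Lemma cone_inj_cocycle n (y : F n) :
  cc_diff F n y = 0 -> cc_diff cone n.+1 (cone_inj n y) = 0.
Proof. by move=> y0; congr pair; rewrite /= linear0 // y0 subr0. Qed.

Lemma cone_inj_tboundary n (y : F n) :
  tboundary a y -> tboundary a (cone_inj n y).
Proof.
case: n y => [|n] y.
  by move=> ->; exists 0; rewrite ?rpred0 ?linear0.
case=> z zT ->; exists (0, - z); first by rewrite torsion_pair ?rpred0 ?submodN.
by congr pair; rewrite /= !linear0 // linearN sub0r opprK.
Qed.

End Cone.

Section ConeResolution.
Variables (A B C : lmodType R) (alpha : {linear A -> B}) (beta : {linear B -> C}).
Hypothesis alpha_inj : injective alpha.
Hypothesis alpha_beta : forall b, beta b = 0 <-> exists x, b = alpha x.
Hypothesis beta_surj : forall c, exists b, c = beta b.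
Variables (E F : cochain R) (eta : {linear B -> E 0}) (eps : {linear C -> F 0}).
Variable u : forall i, {linear E i -> F i}.
Hypotheses (rE : resolution eta) (rF : resolution eps).
Hypothesis lu : lifting eta eps beta u.

Lemma cone_resolution :
  resolution (E := cone lu.1) (comp_map eta alpha : {linear A -> cone lu.1 0}).
Proof.
have [injE eta_inj eta0 Eex] := rE; have [injF eps_inj eps0 Fex] := rF.
case: (lu) => uC u0.
split.
- by case=> [|i]; [exact: injE|exact: prod_injective].
- by move=> x y /= /eta_inj/alpha_inj.
- move=> z; split=> [[dz uz]|[m ->]]; last first.
    congr pair; first by apply/eta0; exists (alpha m).
    by rewrite /= u0 (_ : beta _ = 0) ?linear0 //; apply/alpha_beta; exists m.
  have [b zE] := (eta0 z).1 dz; rewrite zE u0 in uz.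
  have /alpha_beta[m bE] : beta b = 0 by apply: eps_inj; rewrite uz linear0.
  by exists m; rewrite zE bE.
move=> i z; split=> [|[y ->]]; last exact: cc_diffK.
case: z => x y [dx uxy].
have [x0 xE] := (Eex i x).1 dx.
have yc : cc_diff F i (y - u i x0) = 0.
  by rewrite linearB uC -xE; apply/eqP; rewrite -oppr_eq0 opprB; apply/eqP.
case: i x y dx uxy x0 xE yc => [|i] x y dx uxy x0 xE yc.
  (* In the lowest degree y - u x0 is no coboundary but comes from [C]. Surjectivity of [beta] lifts
     it to [B], and adding [eta b] to [x0] absorbs it. *)
  have [c cE] := (eps0 _).1 yc; have [b bE] := beta_surj c.
  exists (x0 + eta b); congr pair.
    by rewrite linearD -xE (_ : cc_diff E 0 (eta b) = 0) ?addr0 //; apply/eta0; exists b.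
  by rewrite linearD u0 -bE -cE addrC subrK.
have [y0 yE] := (Fex _ _).1 yc; exists (x0, - y0); congr pair => //=.
by rewrite linearN opprK -yE addrC subrK.
Qed.

End ConeResolution.

Section Sequence.
Variables (A B C : lmodType R) (alpha : {linear A -> B}) (beta : {linear B -> C}).
Hypothesis alpha_inj : injective alpha.
Hypothesis alpha_beta : forall b, beta b = 0 <-> exists x, b = alpha x.
Hypothesis beta_surj : forall c, exists b, c = beta b.

(** The cone and the chosen resolution both resolve [A], so the liftings [phi] and [psi] of the
    identity, written [scale_map A 1], are mutually inverse on classes. The connecting map is y ->
    (0, y) followed by [psi]. *)
Lemma local_cohomology_exact :
  (forall i h, local_cohomology_map a beta i h = 0 ->
     exists w, h = local_cohomology_map a alpha i w) /\
  forall i, exists delta : {linear local_cohomology a i C -> local_cohomology a i.+1 A},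
    (forall h, delta h = 0 -> exists w, h = local_cohomology_map a beta i w) /\
    (forall h, local_cohomology_map a alpha i.+1 h = 0 -> exists w, h = delta w).
Proof.
have [[rA rB] rC] := (resolution_mapP A, resolution_mapP B, resolution_mapP C).
have [u lu] := lifting_exists beta rB rC.
have rK := cone_resolution alpha_inj alpha_beta beta_surj rB rC lu.
have [phi lphi] := lifting_exists (scale_map A 1) rA rK.
have [psi lpsi] := lifting_exists (scale_map A 1) rK rA.
have lp : lifting (comp_map (resolution_map B) alpha : {linear A -> cone lu.1 0})
    (resolution_map B) alpha (cone_proj lu.1).
  by split; [exact: cone_proj_chain_map|].
have lpphi : lifting (resolution_map A) (resolution_map B) alpha
    (fun i => comp_map (cone_proj lu.1 i) (phi i)).
  by apply: lifting_ext (lifting_comp lphi lp) => m; rewrite /= scale1r.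
have phipsi i z : tcocycle a z -> hclass a (phi i (psi i z)) = hclass a z.
  move=> tz; have l1 := lifting_comp lpsi lphi.
  rewrite (lifting_hclass (v := fun i => scale_map _ 1) rK rK l1 _ tz) /= ?scale1r //.
  by apply: lifting_ext (lifting_id _) => m; rewrite /= !scale1r.
have psiphi i z : tcocycle a z -> hclass a (psi i (phi i z)) = hclass a z.
  move=> tz; have l1 := lifting_comp lphi lpsi.
  rewrite (lifting_hclass (v := fun i => scale_map _ 1) rA rA l1 _ tz) /= ?scale1r //.
  by apply: lifting_ext (lifting_id _) => m; rewrite /= !scale1r.
have psic i (z : cone lu.1 i) : tcocycle a z -> tcocycle a (psi i z).
  exact: chain_map_tcocycle lpsi.1.
have phic i z : tcocycle a z -> tcocycle a (phi i z).
  exact: chain_map_tcocycle lphi.1.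
have injc i y : tcocycle a y -> tcocycle a (cone_inj lu.1 i y).
  by move=> [yT y0]; split; [exact: torsion_linear|exact: cone_inj_cocycle].
split=> [i h|i].
  have [x tx ->] := hclass_surj h.
  rewrite (local_cohomology_mapE lu tx) => /(hclass_eq0 (chain_map_tcocycle lu.1 tx)).
  move=> /(cone_exact_proj lu.1 tx)[z tz <-]; exists (hclass a (psi i z)).
  rewrite (local_cohomology_mapE lpphi (psic _ _ tz)) /=.
  apply: (chain_map_hclass (u := cone_proj lu.1)) => //.
  - exact: cone_proj_chain_map.
  - exact/phic/psic.
  - by rewrite phipsi.
have [|y ty yb|delta deltaE] :=
    @hclass_map _ a _ _ i i.+1 (comp_map (psi i.+1) (cone_inj lu.1 i)).
- by move=> y ty; case: (psic _ _ (injc _ _ ty)).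
- by apply: chain_map_tboundary lpsi.1 _; exact: cone_inj_tboundary.
exists delta; split=> h.
  have [y ty ->] := hclass_surj h; rewrite deltaE //= => psi0.
  have : tboundary a (cone_inj lu.1 i y).
    apply/(hclass_eq0 (injc _ _ ty)); rewrite -phipsi; last exact: injc.
    apply/hclass_eq0; first exact/phic/psic/injc.
    apply: chain_map_tboundary lphi.1 _; apply/hclass_eq0 => //.
    exact/psic/injc.
  case/(cone_exact_inj ty)=> x tx yx; exists (hclass a x).
  rewrite (local_cohomology_mapE lu tx).
  by apply/hclass_eq => //; apply: chain_map_tcocycle lu.1 tx.
have [z tz ->] := hclass_surj h.
rewrite (local_cohomology_mapE lpphi tz) /= => p0.
have [y ty yz] : exists2 y, tcocycle a y &
    tboundary a (phi i.+1 z - cone_inj lu.1 i y).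
  apply: cone_exact_res; first exact: phic.
  apply/hclass_eq0 => //; apply: (chain_map_tcocycle lp.1); exact: phic.
exists (hclass a y); rewrite deltaE //= -psiphi //.
apply: (chain_map_hclass lpsi.1); [exact: phic|exact: injc|].
by apply/hclass_eq => //; [exact: phic|exact: injc].
Qed.

End Sequence.
End LongExactSequence.

(** * Vanishing and multiplication maps *)

Section LocalCohomology.
Local Open Scope ring_scope.
Variables (R : comPzRingType) (a : ideal R).
Hypothesis R_noetherian : noetherian R.

(** The torsion parts of injective modules are injective and torsion, so [M] has an injective
    resolution with torsion terms. There the torsion functor changes nothing, and exactness in
    positive degrees persists. Comparison carries this to the chosen resolution. *)
Lemma torsion_acyclic (M : lmodType R) i (h : local_cohomology a i.+1 M) :
  (forall m, m \in torsion a M) -> h = 0.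
Proof.
move=> MT.
have [|N NT|G [eta [rG GT]]] :=
    @build_resolution R (fun N => forall m : N, m \in torsion a N) _ _ M MT.
- by move=> N N' NT q; have [m ->] := quot_map_surj q; apply: torsion_linear.
- have [E [injE [eta eta_inj]]] := enough_injectives N.
  have etaT m : eta m \in torsion a E by apply: torsion_linear.
  exists (submod (torsion a E)); split.
  + move=> [e eT]; have /mem_mksubmod[t et] := eT.
    apply/mem_mksubmod; exists t => r /et re; exact: val_inj.
  + exact: torsion_injective.
  + by exists (corestrict etaT) => m m' /(congr1 val)/eta_inj.
have rM := resolution_mapP M.
have [u lu] := lifting_exists (scale_map M 1) rM rG.
have [v lv] := lifting_exists (scale_map M 1) rG rM.
have [z tz ->] := hclass_surj h.
have -> : hclass a z = hclass a (v _ (u _ z)).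
  have l1 := lifting_comp lu lv; apply/esym.
  rewrite (lifting_hclass (v := fun i => scale_map _ 1) rM rM l1 _ tz) /= ?scale1r //.
  by apply: lifting_ext (lifting_id _) => m; rewrite /= !scale1r.
have tu := chain_map_tcocycle lu.1 tz.
apply/hclass_eq0; first exact: chain_map_tcocycle lv.1 tu.
apply: chain_map_tboundary lv.1 _.
have [_ _ _ Gex] := rG; have [y yE] := (Gex _ _).1 tu.2.
by exists y; [exact: GT|exact: yE].
Qed.

Section Multiplication.
Variables (N Q : lmodType R) (x : R) (q : {linear N -> Q}).
Hypothesis q_surj : forall n, exists m, n = q m.
Hypothesis q_ker : forall n, q n = 0 <-> exists m, n = x *: m.

Local Notation K := (submod (kermod (scale_map N x))).
Local Notation xN := (submod (imgmod (scale_map N x))).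

Fact mem_scale_image (n : N) : scale_map N x n \in imgmod (scale_map N x).
Proof. by apply/mem_mksubmod; exists n. Qed.

Local Notation pi := (corestrict mem_scale_image).
Local Notation iota := (submod_incl (imgmod (scale_map N x))).

Lemma kernel_sequence : [/\ injective (submod_incl (kermod (scale_map N x))),
  forall n, pi n = 0 <-> exists k : K, n = submod_incl _ k
  & forall y, exists n, y = pi n].
Proof.
split; first exact: submod_incl_inj.
- move=> n; split=> [/(congr1 val) /= n0|[[k kK] ->]].
    have nK : n \in kermod (scale_map N x) by apply/mem_mksubmod.
    by exists (Submod nK).
  by apply: val_inj; move/mem_mksubmod: (kK).
- move=> [y yN]; have /mem_mksubmod[n yE] := yN; exists n; exact: val_inj.
Qed.

Lemma image_sequence : [/\ injective iota,
  forall n, q n = 0 <-> exists y, n = iota y & forall c, exists n, c = q n].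
Proof.
split=> [|n|]; [exact: submod_incl_inj| |exact: q_surj].
rewrite q_ker; split=> [[m ->]|[[y yN] ->]]; last by move/mem_mksubmod: (yN).
by exists (pi m).
Qed.

(** Multiplication by [x] on cohomology factors as [pi] followed by [iota]. Vanishing for [Q] makes
    [iota] injective in degree [i.+1], and vanishing for [K] makes [pi] injective there. *)
Lemma mul_injective i :
  (forall h : local_cohomology a i.+1 K, h = 0) ->
  (forall h : local_cohomology a i Q, h = 0) ->
  forall h : local_cohomology a i.+1 N, x *: h = 0 -> h = 0.
Proof.
move=> HK HQ h xh.
have [k1 k2 k3] := kernel_sequence; have [i1 i2 i3] := image_sequence.
have [ex1 _] := local_cohomology_exact a k1 k2 k3.
have [_ /(_ i)[delta [_ ex2]]] := local_cohomology_exact a i1 i2 i3.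
have : local_cohomology_map a iota i.+1 (local_cohomology_map a pi i.+1 h) = 0.
  by rewrite (@local_cohomology_map_scale _ _ _ _ _ _ x).
case/ex2=> w; rewrite (HQ w) linear0 => /ex1[k ->].
by rewrite (HK k) linear0.
Qed.

Lemma mul_surjective i :
  (forall h : local_cohomology a i.+1 K, h = 0) ->
  (forall h : local_cohomology a i Q, h = 0) ->
  forall h : local_cohomology a i N, exists h', h = x *: h'.
Proof.
move=> HK HQ h.
have [k1 k2 k3] := kernel_sequence; have [i1 i2 i3] := image_sequence.
have [_ /(_ i)[delta [ex1 _]]] := local_cohomology_exact a k1 k2 k3.
have [ex2 _] := local_cohomology_exact a i1 i2 i3.
have [w ->] := ex2 _ _ (HQ (local_cohomology_map a q i h)).
have [h' ->] := ex1 _ (HK (delta w)); exists h'.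
by rewrite (@local_cohomology_map_scale _ _ _ _ _ _ x).
Qed.

(** [W] is at once a quotient of the cohomology of [N] in degree [i.+1] and the target of the
    connecting map on [Q] in degree [i]. Finiteness of the two cohomology modules of [N] thus bounds
    that of [Q]. *)
Lemma mul_connecting i :
  (forall h : local_cohomology a i.+2 K, h = 0) ->
  exists (W : lmodType R) (sigma : {linear local_cohomology a i.+1 N -> W})
    (delta : {linear local_cohomology a i Q -> W}),
    (forall w, exists h, w = sigma h) /\
    (forall h, delta h = 0 -> exists w, h = local_cohomology_map a q i w).
Proof.
move=> HK.
have [k1 k2 k3] := kernel_sequence; have [i1 i2 i3] := image_sequence.
have [_ /(_ i.+1)[delta [ex1 _]]] := local_cohomology_exact a k1 k2 k3.
have [_ /(_ i)[delta' [ex2 _]]] := local_cohomology_exact a i1 i2 i3.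
exists (local_cohomology a i.+1 xN), (local_cohomology_map a pi i.+1), delta'.
by split=> // w; apply: ex1; exact: HK.
Qed.

End Multiplication.

Lemma quot_scale_ker (N : lmodType R) (x : R) n :
  quot_map (imgmod (scale_map N x)) n = 0 <-> exists m, n = x *: m.
Proof. by rewrite quot_map_eq0 mem_mksubmod. Qed.

Section DegreeZero.
Variable N : lmodType R.

Lemma torsion_tcocycle (m : N) :
  m \in torsion a N -> tcocycle a (resolution_map N m).
Proof.
move=> mT; split; first exact: torsion_linear.
by have [_ _ eta0 _] := resolution_mapP N; apply/eta0; exists m.
Qed.

Lemma hclass0_inj (m : N) :
  m \in torsion a N -> hclass a (resolution_map N m) = 0 -> m = 0.
Proof.
move=> mT /(hclass_eq0 (torsion_tcocycle mT)) /= m0.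
by have [_ eta_inj _ _] := resolution_mapP N; apply: eta_inj; rewrite m0 linear0.
Qed.

Lemma local_cohomology0_eq0 : (forall m, m \in torsion a N -> m = 0) ->
  forall h : local_cohomology a 0 N, h = 0.
Proof.
move=> N0 h; have [z tz ->] := hclass_surj h.
have [_ eta_inj eta0 _] := resolution_mapP N.
have [m zE] := (eta0 z).1 tz.2; apply/hclass_eq0 => //=.
rewrite zE (N0 m) ?linear0 //.
have /mem_mksubmod[t zt] := tz.1; apply/mem_mksubmod; exists t => r /zt.
by rewrite zE -linearZ_LR -(linear0 (resolution_map N)) => /eta_inj.
Qed.

End DegreeZero.

(** The inclusion of [a] in the radical of <z> + Ann N, phrased by actions so that it passes easily
    to submodules and quotients. *)
Definition covered (z : seq R^o) (N : lmodType R) : Prop :=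
  forall r : R^o, r \in a -> exists n, exists2 y : R^o, y \in genmod z &
    forall m : N, (r : R) ^+ n *: m = (y : R) *: m.

Lemma covered_behead (z1 : R^o) (z : seq R^o) (N N' : lmodType R) :
  (forall r : R, (forall m : N, r *: m = 0) -> forall m : N', r *: m = 0) ->
  (forall m : N', (z1 : R) *: m = 0) -> covered (z1 :: z) N -> covered z N'.
Proof.
move=> NN' z1N' cN r /cN[n [_ /genmod_cons[k [y yz ->]] ry]].
exists n, y => // m; apply/eqP; rewrite -subr_eq0 -scalerBl.
rewrite -(NN' (r ^+ n - (k *: z1 + y)) _ m); last first.
  by move=> m'; rewrite scalerBl ry subrr.
rewrite !scalerBl scalerDl -[k *: z1]/((k : R) * z1) -scalerA z1N' scaler0.
by rewrite add0r.
Qed.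

Lemma covered_kernel (z1 : R^o) (z : seq R^o) (N : lmodType R) :
  covered (z1 :: z) N -> covered z (submod (kermod (scale_map N z1))).
Proof.
apply: covered_behead => [r rN|] [m mK]; apply: val_inj => /=; first exact: rN.
by move/mem_mksubmod: (mK).
Qed.

Lemma covered_quot (z1 : R^o) (z : seq R^o) (N Q : lmodType R) (q : {linear N -> Q}) :
  (forall c, exists n, c = q n) -> (forall n, q ((z1 : R) *: n) = 0) ->
  covered (z1 :: z) N -> covered z Q.
Proof.
move=> q_surj qz; apply: covered_behead => [r rN|] c; have [n ->] := q_surj c.
  by rewrite -linearZ_LR rN linear0.
by rewrite -linearZ_LR qz.
Qed.

Lemma covered_nil_torsion (N : lmodType R) m : covered [::] N -> m \in torsion a N.
Proof.
move=> cN; apply/(torsionP _ _ R_noetherian) => r /cN[n [y /genmod_nil-> rm]].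
by exists n; rewrite rm scale0r.
Qed.

(** By induction the cohomology of 0 :_N z1 and of N / z1 N vanishes in the degrees concerned, so
    [z1] acts injectively. Since a power of [z1] kills each class, all classes are zero. With [z]
    empty the module is torsion. *)
Lemma local_cohomology_vanish (z : seq R^o) (N : lmodType R) i :
  {subset z <= a} -> covered z N -> (size z < i)%N ->
  forall h : local_cohomology a i N, h = 0.
Proof.
elim: z N i => [|z1 z IH] N [|i] // za cN zi h.
  by apply: torsion_acyclic => m; apply: covered_nil_torsion.
have za' : {subset z <= a} by move=> r rz; apply: za; rewrite in_cons rz orbT.
have [n] := local_cohomology_torsion h (za z1 (mem_head _ _)).
elim: n h => [|n IHn] h; first by rewrite scale1r.
rewrite exprSr -scalerA => /IHn.
apply: (mul_injective (@quot_map_surj _ _ _) (@quot_scale_ker N z1)) => {h IHn}h.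
  by apply: IH => //; [exact: covered_kernel|exact: leqW].
apply: IH => //; apply: (covered_quot (@quot_map_surj _ N _) _ cN) => m.
by apply/quot_scale_ker; exists m.
Qed.

End LocalCohomology.

(** * Filter regularity *)

Section FilterRegularity.
Local Open Scope ring_scope.
Variables (R : comPzRingType) (a : ideal R).
Hypothesis R_noetherian : noetherian R.
Hypothesis a_jacobson : forall r : R^o, r \in a -> in_jacobson_radical r.

(** On local cohomology the point is that [n] does not depend on [h]. *)
Definition nilpotent_action (H : lmodType R) : Prop :=
  forall r : R^o, r \in a -> exists n, forall h : H, (r : R) ^+ n *: h = 0.

Lemma fg_nilpotent_action i (N : lmodType R) :
  finitely_generated (local_cohomology a i N) ->
  nilpotent_action (local_cohomology a i N).
Proof.
move=> [s sH] r ra.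
have [n sn] : exists n, forall h, h \in s -> (r : R) ^+ n *: h = 0.
  elim: s {sH} => [|h s [n sn]]; first by exists 0%N.
  have [k hk] := local_cohomology_torsion h ra; exists (k + n)%N => h'.
  rewrite in_cons => /orP[/eqP->|/sn h'0].
    by rewrite addnC exprD -scalerA hk scaler0.
  by rewrite exprD -scalerA h'0 scaler0.
exists n => h; suff : h \in kermod (scale_map _ ((r : R) ^+ n)) by move/mem_mksubmod.
by apply: genmod_min (sH h) => h' /sn h'0; apply/mem_mksubmod.
Qed.

Lemma zero_torsion (N : lmodType R) (m : N) : m = 0 -> m \in torsion a N.
Proof. by move=> ->; exact: rpred0. Qed.

(* [W] is [H^(i+1)_a(xN)]. *)
Lemma regular_connecting (N : lmodType R) (x : R) i :
  (forall m : N, x *: m = 0 -> m = 0) ->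
  let Q := quotmod (imgmod (scale_map N x)) in
  exists (W : lmodType R) (sigma : {linear local_cohomology a i.+1 N -> W})
    (delta : {linear local_cohomology a i Q -> W}),
    (forall w, exists h, w = sigma h) /\
    (forall h, delta h = 0 ->
      exists w, h = local_cohomology_map a (quot_map (imgmod (scale_map N x))) i w).
Proof.
move=> xreg; apply: mul_connecting.
- exact: quot_map_surj.
- exact: quot_scale_ker.
move=> h; apply: (torsion_acyclic R_noetherian) => -[m mK].
by apply/zero_torsion/val_inj/xreg; move/mem_mksubmod: (mK).
Qed.

Lemma nilpotent_action_quot (N : lmodType R) (x : R) i :
  (forall m : N, x *: m = 0 -> m = 0) ->
  nilpotent_action (local_cohomology a i N) ->
  nilpotent_action (local_cohomology a i.+1 N) ->
  nilpotent_action (local_cohomology a i (quotmod (imgmod (scale_map N x)))).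
Proof.
move=> xreg Hi HSi r ra; have [n rn] := Hi r ra; have [k rk] := HSi r ra.
have [W [sigma [delta [sigma_surj ex]]]] := regular_connecting i xreg.
exists (n + k)%N => h; rewrite exprD -scalerA.
have [|w ->] := ex ((r : R) ^+ k *: h).
  have [h' h'E] := sigma_surj (delta h).
  by rewrite linearZ_LR h'E -linearZ_LR rk linear0.
by rewrite -linearZ_LR rn linear0.
Qed.

(* [Gamma_a(N/xN)] embeds into [H^1_a(N)] when [x] is regular and
   [Gamma_a(N) = 0]. *)
Lemma torsion_quot_exponent (N : lmodType R) (x r : R) n :
  (forall m : N, x *: m = 0 -> m = 0) -> (forall m, m \in torsion a N -> m = 0) ->
  (forall h : local_cohomology a 1 N, r ^+ n *: h = 0) ->
  forall p : quotmod (imgmod (scale_map N x)), p \in torsion a _ -> r ^+ n *: p = 0.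
Proof.
move=> xreg N0 rn p pT.
have [W [sigma [delta [sigma_surj ex]]]] := regular_connecting 0 xreg.
have tp := torsion_tcocycle pT.
apply: (@hclass0_inj _ a); first by rewrite rpredZ.
rewrite linearZ_LR hclassZ //.
have [|w ->] := ex (r ^+ n *: hclass a (resolution_map _ p)).
  have [h' h'E] := sigma_surj (delta (hclass a (resolution_map _ p))).
  by rewrite linearZ_LR h'E -linearZ_LR rn linear0.
by rewrite (local_cohomology0_eq0 N0 w) linear0.
Qed.

Lemma torsion_quot_free (N : lmodType R) p :
  p \in torsion a (quotmod (torsion a N)) -> p = 0.
Proof.
have [m ->] := quot_map_surj p => /(torsionP _ _ R_noetherian) mT.
apply/quot_map_eq0/(torsionP _ _ R_noetherian) => r ra.
have [n] := mT r ra; rewrite -linearZ_LR => /quot_map_eq0.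
move=> /(torsionP _ _ R_noetherian)/(_ r ra)[k]; rewrite scalerA -exprD => rm.
by exists (k + n)%N.
Qed.

Lemma nilpotent_action_quot_torsion (N : lmodType R) i :
  nilpotent_action (local_cohomology a i N) ->
  nilpotent_action (local_cohomology a i (quotmod (torsion a N))).
Proof.
move=> HN r ra; have [n rn] := HN r ra; exists n => h.
have ker m : quot_map (torsion a N) m = 0 <-> exists k, m = submod_incl (torsion a N) k.
  rewrite quot_map_eq0; split=> [mT|[[k kT] ->]] //.
  by exists (Submod mT).
have [_ /(_ i)[delta [ex _]]] := local_cohomology_exact a
  (@submod_incl_inj _ _ (torsion a N)) ker (@quot_map_surj _ _ _).
have [|w ->] := ex h.
  apply: (torsion_acyclic R_noetherian) => -[k kT].
  have /mem_mksubmod[t kt] := kT; apply/mem_mksubmod; exists t => s st.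
  by apply: val_inj; exact: kt.
by rewrite -linearZ_LR rn linear0.
Qed.

Lemma fg_quotmod (N : lmodType R) (L : submodClosed N) :
  finitely_generated N -> finitely_generated (quotmod L).
Proof. exact: (fg_surj (@quot_map_surj _ N L)). Qed.

(* Assume [Gamma_a(N) = 0] and let [y] be a regular element of [z1 + (z', w)]
   with [w m = 0].  By induction [m] is torsion in every [N/y^s N], so a power of
   [r] killing [H^1_a(N)] maps [m] into [y^s N] for all [s]. *)
Lemma covered_element_torsion (z : seq R^o) (N : lmodType R) (m : N) :
  {subset z <= a} -> finitely_generated N ->
  (forall i, (i <= size z)%N -> nilpotent_action (local_cohomology a i N)) ->
  (forall r : R^o, r \in a -> exists n, exists2 y : R^o, y \in genmod z &
    (r : R) ^+ n *: m = (y : R) *: m) ->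
  m \in torsion a N.
Proof.
elim: z N m => [|z1 z IH] N m za fgN HN cm.
  apply/(torsionP _ _ R_noetherian) => r /cm[n [y /genmod_nil-> rm]].
  by exists n; rewrite rm scale0r.
have za' : {subset z <= a} by move=> r rz; apply: za; rewrite in_cons rz orbT.
have gza : {subset genmod z <= a} by apply: genmod_min.
have z1a : z1 \in a by apply: za; rewrite mem_head.
(* Passage to N modulo its torsion: that quotient is torsion-free, and the hypotheses survive
   because the torsion submodule is acyclic. *)
wlog N0 : N m fgN HN cm / forall m, m \in torsion a N -> m = 0.
  move=> main; apply/quot_map_eq0; apply: torsion_quot_free; apply: main => //.
  - exact: fg_quotmod.
  - by move=> i /HN; exact: nilpotent_action_quot_torsion.
  - move=> r /cm[n [y yz rm]]; exists n, y => //.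
    by rewrite -!linearZ_LR rm.
  - exact: torsion_quot_free.
have Ic : prop_submod_closed (fun w : R^o => exists w1 w2 : R^o,
    [/\ w1 \in genmod z, w2 \in a, (w2 : R) *: m = 0 & w = w1 + w2]).
  split=> [|_ _ [w1 [w2 [w1z w2a w2m ->]]] [v1 [v2 [v1z v2a v2m ->]]]|
           k _ [w1 [w2 [w1z w2a w2m ->]]]].
  - by exists 0, 0; rewrite !rpred0 scale0r addr0.
  - exists (w1 + v1), (w2 + v2); rewrite !rpredD // addrACA.
    by split=> //; rewrite scalerDl w2m v2m addr0.
  - exists (k *: w1), (k *: w2); rewrite !rpredZ // scalerDr.
    by split=> //; rewrite -[k *: w2]/((k : R) * w2) -scalerA w2m scaler0.
have [|w wI yreg] := regular_coset R_noetherian (fg_noetherian R_noetherian fgN)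
  (z := z1) (I := mksubmod Ic).
  (* If [z1] and the whole ideal killed [l], every r in [a] would act nilpotently on [l], making [l]
     torsion and hence zero. *)
  move=> l [l0 _] z1l; apply: contrapT => Il; apply: l0; apply: N0.
  have {}Il (v : R^o) : v \in mksubmod Ic -> (v : R) *: l = 0.
    by move=> vI; apply: contrapT => vl; apply: Il; exists v.
  apply/(torsionP _ _ R_noetherian) => r ra.
  have [n [_ /genmod_cons[k [y yz ->]] rm]] := cm r ra.
  (* The extra factor [r] puts [v] in [a] even when [n] is 0. *)
  exists n.+1; pose v : R := r * (r ^+ n - (k *: z1 + y)).
  have ya : k *: z1 + y \in a by rewrite rpredD ?rpredZ // gza.
  have -> : (r : R) ^+ n.+1 = v + r * (k *: z1 + y).
    by rewrite /v mulrBr subrK exprS.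
  have vl : v *: l = 0.
    apply: (Il v); apply/mem_mksubmod; exists 0, v; rewrite rpred0 add0r.
    split=> //; last by rewrite /v -scalerA scalerBl rm subrr scaler0.
    have -> : (v : R^o) = (r ^+ n - (k *: z1 + y) : R) *: r by rewrite /v mulrC.
    exact: submodZ.
  have yl : (y : R) *: l = 0.
    apply: Il; apply/mem_mksubmod; exists y, 0.
    by rewrite rpred0 scale0r addr0.
  rewrite scalerDl vl add0r -scalerA scalerDl yl addr0.
  by rewrite -[k *: z1]/((k : R) * z1) -scalerA z1l !scaler0.
have [w1 [w2 [w1z w2a w2m wE]]] := (mem_mksubmod Ic w).1 wI.
pose y : R^o := z1 + w.
have ya : y \in a by rewrite /y wE !rpredD // gza.
apply/(torsionP _ _ R_noetherian) => r ra.
have [n rn] := HN 1%N isT r ra; exists n.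
apply: (krull_regular R_noetherian fgN (a_jacobson ya) yreg) => s.
have ysreg (v : N) : (y : R) ^+ s *: v = 0 -> v = 0.
  elim: s => [|s IHs]; first by rewrite scale1r.
  by rewrite exprS -scalerA => /yreg.
suff qmT : quot_map (imgmod (scale_map N ((y : R) ^+ s))) m \in torsion a _.
  apply/quot_scale_ker; rewrite linearZ_LR.
  exact: torsion_quot_exponent qmT.
apply: IH => //.
- exact: fg_quotmod.
- by move=> i iz; apply: nilpotent_action_quot => //; apply: HN; rewrite ?(leq_trans iz).
move=> r' /cm[k [_ /genmod_cons[c [v vz ->]] rm]].
(* On [m], z1 acts as y - w1 since [w2] kills [m]. Hence r'^k acts on [m] as v' + c y, with [v'] in
   <z>. *)
pose v' : R := v - c * w1.
have v'z : (v' : R^o) \in genmod z by rewrite /v' submodB //; exact: (submodZ c w1z).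
have rvm : ((r' : R) ^+ k - v') *: m = (c * y) *: m.
  rewrite scalerBl rm -scalerBl /v' /y wE -[c *: z1]/((c : R) * z1).
  rewrite opprB addrACA subrr addr0 -mulrDr addrA [c * (_ + w2)]mulrDr.
  by rewrite [RHS]scalerDl -[(c * w2) *: m]scalerA w2m scaler0 addr0.
have rvsm : ((r' : R) ^+ k - v') ^+ s *: m = (c * y) ^+ s *: m.
  elim: (s) => // t IHt.
  by rewrite exprS -scalerA IHt scalerA mulrC -scalerA rvm scalerA -exprSr.
exists (k * s)%N; rewrite exprM.
(* The difference of s-th powers is a multiple of [v'], while (r'^k - v')^s m = (c y)^s m vanishes
   modulo y^s N. So r'^(k s) acts on the class of [m] as an element of <z>. *)
have := subrXX ((r' : R) ^+ k) ((r' : R) ^+ k - v') s.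
rewrite subKr; set S := \sum_(i < s) _ => XX.
exists (v' * S); first by rewrite mulrC; exact: (submodZ S v'z).
rewrite -XX scalerBl -[LHS]subr0; congr (_ - _); apply/esym.
rewrite -linearZ_LR rvsm exprMn mulrC -scalerA.
by apply/quot_scale_ker; exists (c ^+ s *: m).
Qed.

End FilterRegularity.

(** * The invariant and its descent to quotients *)

Section Invariant.
Local Open Scope ring_scope.
Variables (R : comPzRingType) (a : ideal R).
Hypothesis R_noetherian : noetherian R.
Hypothesis a_jacobson : forall r : R^o, r \in a -> in_jacobson_radical r.

(* What passes from [N] and [z1 :: z] to [N / z1 N] and [z]. *)
Record generalized_sop (z : seq R^o) (N : lmodType R) : Prop := GeneralizedSop {
  gsop_fg : finitely_generated N;
  gsop_sub : {subset z <= a};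
  gsop_covered : covered a z N;
  gsop_fg_below : forall i, (i < size z)%N ->
    finitely_generated (local_cohomology a i N);
  gsop_neq0 : exists h : local_cohomology a (size z) N, h <> 0 }.

Lemma gsop_filter (z1 : R^o) (z : seq R^o) (N : lmodType R) (m : N) :
  generalized_sop (z1 :: z) N -> (z1 : R) *: m = 0 -> m \in torsion a N.
Proof.
move=> [fgN za cN HN _] z1m.
apply: (covered_element_torsion R_noetherian a_jacobson (z := z)) => //.
- by move=> r rz; apply: za; rewrite in_cons rz orbT.
- by move=> i iz; apply/fg_nilpotent_action/HN.
move=> r /cN[n [_ /genmod_cons[k [y yz ->]] ry]]; exists n, y => //.
by rewrite ry scalerDl -[k *: z1]/((k : R) * z1) -scalerA z1m scaler0 add0r.
Qed.

Lemma torsion_nilpotent_eq0 (x : R^o) i (N : lmodType R) : x \in a ->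
  (forall h : local_cohomology a i N, (x : R) *: h = 0 -> h = 0) ->
  forall h : local_cohomology a i N, h = 0.
Proof.
move=> xa xinj h; have [n] := local_cohomology_torsion h xa.
elim: n => [|n IH]; first by rewrite scale1r.
by rewrite exprS -scalerA => /xinj.
Qed.

Lemma gsop_quot (z1 : R^o) (z : seq R^o) (N Q : lmodType R) (q : {linear N -> Q}) :
  (forall c, exists n, c = q n) ->
  (forall n, q n = 0 <-> exists m, n = (z1 : R) *: m) ->
  generalized_sop (z1 :: z) N -> generalized_sop z Q.
Proof.
move=> q_surj q_ker gN; case: (gN) => fgN za cN HN [h0 h0n].
have HK i (h : local_cohomology a i.+1 (submod (kermod (scale_map N z1)))) : h = 0.
  apply: (torsion_acyclic R_noetherian) => -[m mK].
  have : m \in torsion a N by apply: (gsop_filter gN); move/mem_mksubmod: (mK).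
  case/mem_mksubmod=> t mt; apply/mem_mksubmod; exists t => r rt.
  by apply: val_inj; exact: mt.
split.
- exact: fg_surj q_surj fgN.
- by move=> r rz; apply: za; rewrite in_cons rz orbT.
- by apply: (covered_quot q_surj _ cN) => n; apply/q_ker; exists n.
- move=> i iz; have [W [sigma [delta [sigma_surj ex]]]] := mul_connecting q_surj q_ker (HK i.+1).
  apply: fg_extension R_noetherian ex _ _; first by apply: HN; exact: leqW.
  by apply: fg_surj sigma_surj _; apply: HN.
(* If the top cohomology of [Q] vanished, [z1] would act injectively on that of [N], where each
   class is killed by a power of [z1]. *)
apply: contrapT => HQ; apply: h0n.
apply: (torsion_nilpotent_eq0 (za z1 (mem_head _ _))).
apply: (mul_injective q_surj q_ker (HK _)) => h.
by apply: contrapT => hn; apply: HQ; exists h.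
Qed.

(** Needed to start the descent, since [M] and its quotient by [seqmul [::] M] are isomorphic but
    distinct types. *)
Lemma gsop_iso (z : seq R^o) (N N' : lmodType R) (f : {linear N -> N'})
  (g : {linear N' -> N}) : cancel f g -> cancel g f ->
  generalized_sop z N -> generalized_sop z N'.
Proof.
move=> fK gK [fgN za cN HN [h hn]].
have surj i (k : local_cohomology a i N') : exists h, k = local_cohomology_map a f i h.
  exists (local_cohomology_map a g i k).
  by rewrite (@local_cohomology_map_scale _ _ _ _ _ _ 1) ?scale1r // => m; rewrite scale1r.
split=> //.
- by apply: fg_surj fgN => y; exists (g y).
- move=> r /cN[n [y yz ry]]; exists n, y => // m.
  by have := congr1 f (ry (g m)); rewrite !linearZ_LR gK.
- by move=> i /HN; apply: fg_surj; exact: surj.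
exists (local_cohomology_map a f _ h) => fh; apply: hn.
rewrite -[h]scale1r -(@local_cohomology_map_scale _ a _ _ f g 1) ?fh ?linear0 //.
by move=> m; rewrite scale1r.
Qed.

End Invariant.

(** * Suprema and infima of sets of natural numbers *)

Section Extrema.
Local Open Scope classical_set_scope.

Lemma le_extnat m n : (extnat m <= extnat n)%E = (m <= n)%N.
Proof. by rewrite /extnat lee_fin lez_nat. Qed.

Lemma supremum_extnatP (A : set nat) n :
  supremum -oo%E [set extnat i | i in A] = extnat n <->
  A n /\ forall i, A i -> (i <= n)%N.
Proof.
rewrite /supremum; split=> [|[An Amax]]; last first.
  case: ifPn => [/eqP A0|_].
    suff : [set extnat i | i in A] (extnat n) by rewrite A0.
    by exists n.
  apply: xget_subset1; last exact: is_subset1_supremums.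
  split=> [_ [i Ai <-]|y yA]; first by rewrite le_extnat Amax.
  by apply: yA; exists n.
case: ifPn => // /set0P[_ [i0 Ai0 _]].
have [exS|nS] := EM (exists x, supremums [set extnat i | i in A] x); last first.
  by rewrite xgetPN // => x Sx; apply: nS; exists x.
have := xgetPex -oo%E exS => /[swap] -> [ub lub].
have Amax i : A i -> (i <= n)%N by move=> Ai; rewrite -le_extnat; apply: ub; exists i.
split=> //; apply: contrapT => An.
have Alt i : A i -> (i < n)%N.
  by move=> Ai; rewrite ltn_neqAle Amax // andbT; apply/eqP => ni; apply: An; rewrite -ni.
(* If [n] were not attained, its predecessor would already be an upper bound. An element of [A]
   below [n] ensures that [n] is positive. *)
have : (extnat n <= extnat n.-1)%E.
  apply: lub => _ [i /Alt ilt <-]; rewrite le_extnat.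
  by rewrite -ltnS (ltn_predK ilt).
by rewrite le_extnat leqNgt ltn_predL (leq_trans _ (Alt _ Ai0)).
Qed.

Lemma infimum_extnat (A : set nat) n :
  A n -> (forall i, A i -> (n <= i)%N) ->
  infimum +oo%E [set extnat i | i in A] = extnat n.
Proof.
move=> An Amin; rewrite /infimum; case: ifPn => [/eqP A0|_].
  suff : [set extnat i | i in A] (extnat n) by rewrite A0.
  by exists n.
apply: xget_subset1; last exact: is_subset1_infimums.
split=> [_ [i Ai <-]|y yA]; first by rewrite le_extnat Amin.
by apply: yA; exists n.
Qed.

Lemma infimum_extnat_lb (A : set nat) n :
  infimum +oo%E [set extnat i | i in A] = extnat n ->
  forall i, A i -> (n <= i)%N.
Proof.
rewrite /infimum; case: ifPn => // _.
have [exS|nS] := EM (exists x, infimums [set extnat i | i in A] x); last first.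
  by rewrite xgetPN // => x Sx; apply: nS; exists x.
have := xgetPex +oo%E exS => /[swap] -> [lb _] i Ai.
by rewrite -le_extnat; apply: lb; exists i.
Qed.

End Extrema.

(** * From the definitions to the invariant and back *)

Section RelativeGeneralizedCohenMacaulay.
Local Open Scope ring_scope.
Variables (R : comPzRingType) (a : ideal R).
Hypothesis R_noetherian : noetherian R.
Hypothesis a_jacobson : forall r : R^o, r \in a -> in_jacobson_radical r.

Lemma gsop_cd (z : seq R^o) (N : lmodType R) :
  generalized_sop a z N -> cd a N = extnat (size z).
Proof.
move=> [fgN za cN HN [h hn]]; apply/supremum_extnatP; split=> [|i [k /eqP kn]].
  by exists h; apply/eqP.
rewrite leqNgt; apply/negP => zi; apply: kn.
exact: (local_cohomology_vanish R_noetherian za cN zi).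
Qed.

Lemma gsop_gen_CM (z : seq R^o) (N : lmodType R) :
  generalized_sop a z N -> relative_gen_CM a N.
Proof.
move=> gN; split; first exact: gsop_fg gN.
rewrite (gsop_cd gN); case: z gN => [|z1 z] gN; [by left|right].
case: gN => fgN za cN HN [h hn]; apply/esym/infimum_extnat => [fgH|i nfg].
  apply: hn; have z1J := a_jacobson (za z1 (mem_head _ _)).
  apply: (nakayama R_noetherian fgH z1J) => {h}h.
  have za' : {subset z <= a} by move=> r rz; apply: za; rewrite in_cons rz orbT.
  (* Both 0 :_N z1 and N / z1 N are covered by the shorter [z], so their cohomology vanishes in the
     required degrees and [z1] acts surjectively on the top cohomology of [N]. *)
  apply: (mul_surjective (@quot_map_surj _ _ _) (@quot_scale_ker _ N z1)) => k.
    by apply: (local_cohomology_vanish R_noetherian za' _ _ k); [exact: covered_kernel|exact: leqW].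
  apply: (local_cohomology_vanish R_noetherian za' _ _ k) => //.
  apply: (covered_quot (@quot_map_surj _ N _) _ cN) => m.
  by apply/quot_scale_ker; exists m.
by rewrite leqNgt; apply/negP => iz; apply/nfg/HN.
Qed.

Lemma gen_CM_gsop (z : seq R^o) (N : lmodType R) :
  relative_gen_CM a N -> relative_sop a N z -> generalized_sop a z N.
Proof.
move=> [fgN CM] [cdN za rad].
have [[h /eqP hn] _] := (supremum_extnatP _ _).1 cdN.
split=> // [r ra|i iz|]; last by exists h.
  have [|n [y yz ry]] := (rad r).2; first by exists 1%N, r => //; rewrite expr1 subrr rpred0.
  exists n, y => // m; apply/eqP; rewrite -subr_eq0 -scalerBl.
  by move/mem_mksubmod: ry => ->.
apply: contrapT => nfg; have := iz; apply/negP; rewrite -leqNgt.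
(* If cd is at most 0, no degree lies below the top. *)
case: CM => [|cdf]; first by rewrite cdN le_extnat; case: (size z) iz.
by apply: infimum_extnat_lb nfg; rewrite -cdN cdf.
Qed.

(** The invariant depends only on the terms and their number; this is the source of the word
    unconditioned. *)
Lemma gsop_perm (y z : seq R^o) (N : lmodType R) :
  perm_eq y z -> generalized_sop a z N -> generalized_sop a y N.
Proof.
move=> yz [fgN za cN HN Hn]; have szE := perm_size yz.
split; rewrite ?szE //.
  by move=> r; rewrite (perm_mem yz); exact: za.
move=> r /cN[n [k kz rk]]; exists n, k => //.
by apply: genmod_sub kz => s; rewrite (perm_mem yz).
Qed.

Lemma mem_seqmul_gen (y : seq R^o) (M : lmodType R) (r : R^o) (m : M) :
  r \in y -> (r : R) *: m \in seqmul y M.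
Proof.
move=> ry; apply/mem_mksubmod; exists [:: (r, m)]; last by rewrite big_seq1.
by rewrite /= mem_genmod //= andbT; apply/mem_mksubmod.
Qed.

Lemma seqmul_min (y : seq R^o) (M : lmodType R) (L : submodClosed M) :
  (forall r : R^o, r \in y -> forall m : M, (r : R) *: m \in L) ->
  {subset seqmul y M <= L}.
Proof.
move=> yL x /mem_mksubmod[s sP ->]; rewrite big_seq; apply: rpred_sum => -[r m].
move=> /(allP sP)/andP[/= ry _] {x s sP}.
have Lc : prop_submod_closed (fun r : R^o => forall m : M, (r : R) *: m \in L).
  split=> [u|s t sL tL u|k s sL u]; first by rewrite scale0r rpred0.
    by rewrite scalerDl rpredD.
  by rewrite -[k *: s]/((k : R) * s) -scalerA rpredZ.
suff : r \in mksubmod Lc by move/mem_mksubmod; apply.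
by apply: genmod_min ry => t /yL tL; apply/mem_mksubmod.
Qed.

Lemma seqmul_rcons (y : seq R^o) (z : R^o) (M : lmodType R) (m : M) :
  m \in seqmul (rcons y z) M <->
  exists k, m - (z : R) *: k \in seqmul y M.
Proof.
split=> [|[k mk]]; last first.
  rewrite -(subrK ((z : R) *: k) m) rpredD //; last first.
    by apply: mem_seqmul_gen; rewrite mem_rcons mem_head.
  apply: seqmul_min mk => r ry u; apply: mem_seqmul_gen.
  by rewrite mem_rcons in_cons ry orbT.
have Lc : prop_submod_closed (fun m : M => exists k, m - (z : R) *: k \in seqmul y M).
  split=> [|u v [k uk] [l vl]|c u [k uk]].
  - by exists 0; rewrite scaler0 subr0 rpred0.
  - by exists (k + l); rewrite scalerDr opprD addrACA rpredD.
  - by exists (c *: k); rewrite scalerA mulrC -scalerA -scalerBr rpredZ.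
move=> mz; apply/(mem_mksubmod Lc); apply: seqmul_min mz => r.
rewrite mem_rcons in_cons => /orP[/eqP->|ry] u; apply/mem_mksubmod.
  by exists u; rewrite subrr rpred0.
by exists 0; rewrite scaler0 subr0 mem_seqmul_gen.
Qed.

(** One term is removed at a time: the kernel of the map [q] from the quotient by [take i y] to the
    quotient by [take i.+1 y] consists of the multiples of the next term, as [gsop_quot]
    requires. *)
Lemma gsop_seqmul (y : seq R^o) (M : lmodType R) i :
  generalized_sop a y M -> (i <= size y)%N ->
  generalized_sop a (drop i y) (quotmod (seqmul (take i y) M)).
Proof.
move=> gM; elim: i => [|i IH] iy.
  rewrite drop0 take0; have [|g gE] := @factor_quotmod R M M (seqmul [::] M) (scale_map M 1).
    move=> x x0; rewrite /= scale1r; apply/genmod_nil.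
    by apply: seqmul_min x0.
  apply: (gsop_iso (f := quot_map _) (g := g) _ _ gM) => [m|q].
    by rewrite gE /= scale1r.
  by have [m ->] := quot_map_surj q; rewrite gE /= scale1r.
have takeE : take i.+1 y = rcons (take i y) (y`_i) by rewrite (take_nth 0).
have [|q qE] := @factor_quotmod R M _ (seqmul (take i y) M)
    (quot_map (seqmul (take i.+1 y) M)).
  move=> x xi; apply/quot_map_eq0; rewrite takeE; apply/seqmul_rcons.
  by exists 0; rewrite scaler0 subr0.
have := IH (ltnW iy); rewrite (drop_nth 0 iy) => gi.
apply: (gsop_quot R_noetherian a_jacobson (q := q) _ _ gi) => [c|n].
  by have [m ->] := quot_map_surj c; exists (quot_map _ m).
have [m ->] := quot_map_surj n; rewrite qE quot_map_eq0 takeE seqmul_rcons.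
split=> [[k mk]|[p]].
  exists (quot_map _ k); rewrite -linearZ_LR; apply/eqP.
  by rewrite -subr_eq0 -linearB; apply/eqP/quot_map_eq0.
have [k ->] := quot_map_surj p; rewrite -linearZ_LR => /eqP.
by rewrite -subr_eq0 -linearB => /eqP/quot_map_eq0 mk; exists k.
Qed.

Lemma gsop_filter_regular (y : seq R^o) (M : lmodType R) :
  generalized_sop a y M -> filter_regular a M y.
Proof.
move=> gM i iy m ym; have := gsop_seqmul gM (ltnW iy); rewrite (drop_nth 0 iy) => gi.
have /(gsop_filter R_noetherian a_jacobson gi) :
    (y`_i : R) *: quot_map (seqmul (take i y) M) m = 0.
  by rewrite -linearZ_LR; apply/quot_map_eq0.
case/mem_mksubmod=> t mt; exists t => r /mt.
by rewrite -linearZ_LR => /quot_map_eq0.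
Qed.

End RelativeGeneralizedCohenMacaulay.

Theorem theorem3p3 (R : comPzRingType) (a : ideal R) (M : lmodType R)
  (c : nat) (x : c.-tuple R^o)
  (R_noetherian : noetherian R)
  (a_jacobson : forall r : R^o, r \in a -> in_jacobson_radical r)
  (M_fg : finitely_generated M)
  (M_gCM : relative_gen_CM a M)
  (cdM : cd a M = extnat c)
  (araM : ara a M = extnat c)
  (x_sop : relative_sop a M x) :
  unconditioned_filter_regular a M x /\
  forall i : nat, (i <= c)%N ->
    relative_gen_CM a (quotmod (seqmul (take i x) M)) /\
    cd a (quotmod (seqmul (take i x) M)) = extnat (c - i).
Proof.
have gx := gen_CM_gsop M_gCM x_sop; split=> [y yx|i ic].
  exact: (gsop_filter_regular R_noetherian a_jacobson (gsop_perm yx gx)).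
have gi : generalized_sop a (drop i x) (quotmod (seqmul (take i x) M)).
  by apply: gsop_seqmul => //; rewrite size_tuple.
split; first exact: gsop_gen_CM gi.
by rewrite (gsop_cd R_noetherian gi) size_drop size_tuple.
Qed.
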